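(* Let the observed variables follow a canonical lvLiNGAM model satisfying the pure-set assumption, the three-child assumption and causal faithfulness. Let $X_i$ and $X_j$ be two dependent observed variables. If $(\{X_i\},\{X_i,X_j\})$ satisfies the One-Latent-Component condition, then $X_i$ is causally earlier than $X_j$.
   Context: Canonical lvLiNGAM: $\mathbf{X}=\mathbf{B}\mathbf{X}+\mathbf{\Lambda}\mathbf{L}+\mathbf{S_X}$, where $\mathbf X$ is the vector of observed variables, $\mathbf L$ the vector of latent confounders, $\mathbf{S_X}$ the vector of noises ($S_{X_i}$ is the noise of $X_i$); all entries of $\mathbf L$ and $\mathbf{S_X}$ are mutually independent, non-Gaussian and zero-mean, latent confounders have unit variance; $\mathbf B$ is the coefficient matrix of an acyclic graph on $\mathbf X$; $\mathbf\Lambda$ has full column rank. The causal graph $\mathcal G$ has an edge $X_l\to X_k$ iff $\mathbf B_{kl}\ne0$ and $L_l\to X_k$ iff $\mathbf\Lambda_{kl}\neq 0$. Equivalently $\mathbf X=\mathbf A\mathbf S$ with $\mathbf A=[(\mathbf I-\mathbf B)^{-1}\mathbf\Lambda\;\;(\mathbf I-\mathbf B)^{-1}]$ and independent components $\mathbf S=[\mathbf L,\mathbf{S_X}]^\top$. Moments are finite and the fourth-order cumulants of the components are nonzero. Assumptions. (Pure set) Each latent confounder has at least one pure set of observed variables as a child; a pure set is a nonempty set of observed variables having no direct connections (edges) to other variables except for at most one latent confounder; edges among variables within the same pure set are allowed. (Three-child) Each latent confounder has at least three observed variables as children. (Causal faithfulness) For observed $X_a,X_b$ and a set $\mathbf C$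 of observed variables not containing them, if $X_a,X_b$ are independent conditional on $\mathbf C$, then they are d-separated by $\mathbf C$ in $\mathcal G$. One-Latent-Component condition: for $\mathbf{Y}$ with at least two elements, $(\mathbf{Z},\mathbf{Y})$ satisfies it iff there exists a non-zero vector $\omega$ with $\omega^\top\widehat{\mathbf A}_{\mathbf{Y},L}=\mathbf 0$ and $\omega^\top\mathbf{Y}$ independent of $\mathbf{Z}$. Here $\widehat{\mathbf A}_{\mathbf{Y},L}$ is the vector of coefficients on $\mathbf{Y}$ computed under the hypothesis that $\mathbf{Z}$ and $\mathbf{Y}$ share exactly one component $L$: for a variable $Z\in\mathbf{Z}$ and $Y\in\mathbf{Y}$, $\hat\alpha_Z=\sqrt{\frac{cum(Z,Z,Y,Y)}{cum(Z,Y,Y,Y)}cum(Z,Y)}$ and the entry for $Y$ is $\hat\alpha_Y=cum(Z,Y)/\hat\alpha_Z$, where $cum$ denotes the joint cumulant. (Here $\mathbf Z=\{X_i\}$, $\mathbf Y=\{X_i,X_j\}$, and the hypothetical shared component is the noise $S_{X_i}$.) ''$X_i$ is causally earlier than $X_j$'' means that $X_i$ is a cause (ancestor) of $X_j$ in $\mathcal G$. *)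

(* Defs.v *)
From HB Require Import structures.
From mathcomp Require Import all_boot all_order all_algebra.
From mathcomp Require Import all_classical all_reals all_analysis.

Set Implicit Arguments.
Unset Strict Implicit.
Unset Printing Implicit Defensive.

Import Order.TTheory GRing.Theory Num.Theory.
Import numFieldNormedType.Exports.

Local Open Scope ring_scope.

Section Graphs.
Context {V : finType}.
Implicit Types (e : rel V) (C : {set V}).

(* Self-loops [e x x] count as cycles. *)
Definition acyclic e : Prop := forall s : seq V, cycle e s -> s = [::].

Definition ancestor e (x y : V) : bool := (x != y) && connect e x y.

Definition adjacent e : rel V := fun x y => e x y || e y x.

(* The middle vertex [y] of a consecutive triple [x], [y], [z] of a trail does
   not block it given [C]: a collider needs itself or a descendant in [C],
   every other vertex must lie outside [C]. *)
Definition open_triple e C (x y z : V) : bool :=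
  if e x y && e z y then [exists c in C, connect e y c] else y \notin C.

Fixpoint open_trail e C (x y : V) (s : seq V) : bool :=
  if s is z :: s' then open_triple e C x y z && open_trail e C y z s'
  else true.

Definition d_connecting e C (x : V) (s : seq V) : bool :=
  [&& path (adjacent e) x s, uniq (x :: s) &
      if s is y :: s' then open_trail e C x y s' else true].

Definition d_separated e C (x y : V) : Prop :=
  forall s : seq V, last x s = y -> ~~ d_connecting e C x s.

End Graphs.

Section Probability.
Context {d : measure_display} {T : measurableType d} {R : realType}.
Variable P : probability T R.

Definition sigma_rv (I : Type) (C : set I) (X : I -> T -> R) : set_system T :=
  (<<s [set E | exists i (A : set R),
         [/\ C i, measurable A & E = X i @^-1` A] ] >>)%classic.

Definition indep_systems (G H : set_system T) : Prop :=
  forall E F, G E -> H F -> P (E `&` F)%classic = (P E * P F)%E.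

Definition indep_vectors (I J : Type) (X : I -> T -> R) (Y : J -> T -> R) :
    Prop :=
  indep_systems (sigma_rv setT X) (sigma_rv setT Y).

Definition indep_rv (X Y : T -> R) : Prop :=
  indep_vectors (fun _ : unit => X) (fun _ : unit => Y).

Definition mutually_independent (I : finType) (X : I -> T -> R) : Prop :=
  forall (J : {set I}) (A : I -> set R), (forall i, measurable (A i)) ->
    P (\bigcap_(i in [set` J]) (X i @^-1` A i))%classic
    = (\prod_(i in J) P (X i @^-1` A i)%classic)%E.

Definition cond_prob_version (G : set_system T) (E : set T) (f : T -> R) :
    Prop :=
  [/\ (forall A : set R, measurable A -> G (f @^-1` A)%classic),
      P.-integrable setT (EFin \o f) &
      forall F, G F -> (\int[P]_(w in F) (f w)%:E)%E = P (E `&` F)%classic].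

(* P(X in A, Y in B | G) = P(X in A | G) P(Y in B | G) almost surely. *)
Definition cond_indep (G : set_system T) (X Y : T -> R) : Prop :=
  forall A B : set R, measurable A -> measurable B ->
    exists f g : T -> R,
      [/\ cond_prob_version G (X @^-1` A)%classic f,
          cond_prob_version G (Y @^-1` B)%classic g &
          cond_prob_version G (X @^-1` A `&` Y @^-1` B)%classic (f \* g)].

(* The guard excludes [s = 0], where [normal_prob] is not Gaussian. *)
Definition gaussian (X : {RV P >-> R}) : Prop :=
  exists m s : R, 0 < s /\
    forall A : set R, measurable A -> distribution P X A = normal_prob m s A.

Definition finite_moments (X : T -> R) : Prop :=
  forall n : nat, P.-integrable setT (EFin \o (fun w => X w ^+ n)).

(* Joint cumulant, as the Moebius sum over the set partitions of the index
   set; [fine] is harmless when the moments involved are finite. *)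
Definition cum (n : nat) (X : n.-tuple (T -> R)) : R :=
  \sum_(Q : {set {set 'I_n}} | finset.partition Q [set: 'I_n])
    (-1) ^+ #|Q|.-1 * (#|Q|.-1)`!%:R *
    \prod_(D in Q) fine 'E_P[fun w => \prod_(i in D) tnth X i w].

End Probability.

Section OneLatentComponent.
Context {d : measure_display} {T : measurableType d} {R : realType}.
Variable P : probability T R.

(* Estimated coefficient of the reference variable [Z], using [Y]. [Num.sqrt]
   vanishes on negative numbers and [x / 0 = 0]. *)
Definition alpha_ref (Z Y : T -> R) : R :=
  Num.sqrt (cum P [tuple Z; Z; Y; Y] / cum P [tuple Z; Y; Y; Y]
            * cum P [tuple Z; Y]).

Definition alpha_hat (Z Y : T -> R) : R := cum P [tuple Z; Y] / alpha_ref Z Y.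

Definition A_hat (n : nat) (Z : T -> R) (Y : n.-tuple (T -> R)) : 'cV[R]_n :=
  \col_k alpha_hat Z (tnth Y k).

Definition lin_comb (n : nat) (omega : 'cV[R]_n) (Y : n.-tuple (T -> R)) :
    T -> R :=
  fun w => \sum_(k < n) omega k 0 * tnth Y k w.

(* [z] selects the element of [Z] from which the coefficients are computed. *)
Definition one_latent_component (m n : nat) (Z : m.-tuple (T -> R))
    (Y : n.-tuple (T -> R)) : Prop :=
  (2 <= n)%N /\
  exists (z : 'I_m) (omega : 'cV[R]_n),
    [/\ omega != 0,
        omega^T *m A_hat (tnth Z z) Y = 0 &
        indep_vectors P (fun _ : unit => lin_comb omega Y) (tnth Z)].

End OneLatentComponent.

Section CausalGraph.
Context {R : realType} {p q : nat}.
Variables (B : 'M[R]_p) (Lam : 'M[R]_(p, q)).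

(* Vertices: [inl l] is the latent confounder L_l, [inr k] the observed X_k. *)
Definition causal_graph : rel ('I_q + 'I_p) := fun u v =>
  match u, v with
  | inl l, inr k => Lam k l != 0
  | inr l, inr k => B k l != 0
  | _, inl _ => false
  end.

Definition causally_earlier (i j : 'I_p) : bool :=
  ancestor causal_graph (inr i) (inr j).

Definition pure_set (W : {set 'I_p}) : Prop :=
  [/\ W != finset.set0,
      (forall k k', k \in W -> k' \notin W ->
         ~~ adjacent causal_graph (inr k) (inr k')) &
      (forall k k' l l', k \in W -> k' \in W ->
         adjacent causal_graph (inl l) (inr k) ->
         adjacent causal_graph (inl l') (inr k') -> l = l')].

Definition pure_set_assumption : Prop :=
  forall l : 'I_q, exists W : {set 'I_p},
    pure_set W /\ exists2 k, k \in W & causal_graph (inl l) (inr k).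

Definition three_child_assumption : Prop :=
  forall l : 'I_q, (3 <= #|[set k | causal_graph (inl l) (inr k)]|)%N.

End CausalGraph.

Section Model.
Context {d : measure_display} {T : measurableType d} {R : realType}.
Variable P : probability T R.
Context {p q : nat}.

Definition components (L : 'I_q -> {RV P >-> R}) (SX : 'I_p -> {RV P >-> R}) :
    'I_q + 'I_p -> {RV P >-> R} :=
  fun c => match c with inl l => L l | inr k => SX k end.

Record canonical_lvLiNGAM (B : 'M[R]_p) (Lam : 'M[R]_(p, q))
    (L : 'I_q -> {RV P >-> R}) (SX X : 'I_p -> {RV P >-> R}) : Prop := {
  lvLiNGAM_eq : forall k w,
    X k w = \sum_j B k j * X j w + \sum_l Lam k l * L l w + SX k w;
  lvLiNGAM_acyclic : acyclic (fun j k : 'I_p => B k j != 0);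
  lvLiNGAM_full_rank : \rank Lam = q;
  lvLiNGAM_indep :
    mutually_independent P (fun c => components L SX c : T -> R);
  lvLiNGAM_nongaussian : forall c, ~ gaussian (components L SX c);
  lvLiNGAM_mean : forall c, ('E_P[components L SX c] = 0)%E;
  lvLiNGAM_latent_var : forall l, ('V_P[L l] = 1)%E;
  lvLiNGAM_moments : forall c, finite_moments P (components L SX c);
  lvLiNGAM_cum4 : forall c, let S : T -> R := components L SX c in
    cum P [tuple S; S; S; S] != 0
}.

Definition causal_faithfulness (B : 'M[R]_p) (Lam : 'M[R]_(p, q))
    (X : 'I_p -> {RV P >-> R}) : Prop :=
  forall (a b : 'I_p) (C : {set 'I_p}),
    a != b -> a \notin C -> b \notin C ->
    cond_indep P (sigma_rv [set` C]%classic (fun k => X k : T -> R)) (X a) (X b) ->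
    d_separated (causal_graph B Lam) [set inr c | c in C] (inr a) (inr b).

End Model.

(* Main.v *)
(* The total effects express X_i and X_j as linear combinations of the mutually
   independent components.  The condition gives weights [u], [v], not both zero,
   with u X_i + v X_j independent of X_i; since X_i and X_j are dependent, u is
   nonzero.  If X_i were not an ancestor of X_j, the noise of X_i would have
   coefficient 1 in X_i and u in u X_i + v X_j, and the Darmois-Skitovich theorem
   would force its fourth cumulant to vanish.

   All moments are finite, so that theorem is proved with formal power series.
   Comparing the cumulants of U + t V, for U and V independent, as polynomials in
   t shows that the partial sum W of U over the components having the same
   coefficient ratio as the given one has only finitely many nonzero cumulants.
   Split W as X + Y with X and Y independent and centred.  The even moments of X
   and Y are bounded by those of W, so the three moment series a, b and e = a b
   are entire, and so is a'/a = a' b / e: hence a = exp g with g entire.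
   Positivity of the moment functional gives Re g(z) <= g(Re z), while
   a(x) <= e(x) + e(-x) bounds g polynomially on the real line.  Averaging over
   roots of unity (Borel-Caratheodory) makes g a polynomial, and the first
   inequality bounds its degree by 2 (Marcinkiewicz), so the fourth cumulant of X
   is 0. *)
Require Import Defs.
From HB Require Import structures.
From mathcomp Require Import all_boot all_order all_algebra.
From mathcomp Require Import all_classical all_reals all_analysis.
From mathcomp Require Import measurable_realfun.
From mathcomp Require Import zify ring lra.

Set Implicit Arguments.
Unset Strict Implicit.
Unset Printing Implicit Defensive.

Import Order.TTheory GRing.Theory Num.Theory.
Import numFieldNormedType.Exports.

Local Open Scope ring_scope.

(** * Formal power series *)

(** A type of its own lets the ring structure carry the Cauchy product rather than a pointwise
    one. *)
Definition fps (R : realType) : Type := nat -> R.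

Section FormalPowerSeries.
Context {R : realType}.
Implicit Types a b c : fps R.

HB.instance Definition _ := GRing.Zmodule.copy (fps R) (nat -> R).

Definition fps_one : fps R := fun n => (n == 0%N)%:R.

Definition fps_mul a b : fps R := fun n => \sum_(i < n.+1) a i * b (n - i)%N.

(** A coefficient of a product involves finitely many coefficients of the factors, so the ring laws
    and the product rule are inherited from polynomials. *)
Let trunc N a : {poly R} := \poly_(i < N) a i.

Let coef_trunc_mul N a b n : (n < N)%N ->
  (trunc N a * trunc N b)`_n = fps_mul a b n.
Proof.
move=> nN; rewrite coefM; apply: eq_bigr => i _.
have iN : (i < N)%N by apply: leq_trans nN; rewrite ltnS -ltnS.
by rewrite !coef_poly iN (leq_ltn_trans (leq_subr _ _) nN).
Qed.

Let fps_mulC : commutative fps_mul.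
Proof.
by move=> a b; apply/funext => n; rewrite -!(@coef_trunc_mul n.+1)// mulrC.
Qed.

Let fps_mulA : associative fps_mul.
Proof.
move=> a b c; apply/funext => n.
have e1 : fps_mul a (fps_mul b c) n
          = (trunc n.+1 a * (trunc n.+1 b * trunc n.+1 c))`_n.
  rewrite coefM; apply: eq_bigr => i _.
  by rewrite coef_poly ltn_ord coef_trunc_mul// ltnS leq_subr.
have e2 : fps_mul (fps_mul a b) c n
          = (trunc n.+1 a * trunc n.+1 b * trunc n.+1 c)`_n.
  rewrite coefM; apply: eq_bigr => i _.
  by rewrite coef_poly ltnS leq_subr coef_trunc_mul.
by rewrite e1 e2 mulrA.
Qed.

Let fps_mul1 : left_id fps_one fps_mul.
Proof.
move=> a; apply/funext => n; rewrite /fps_mul big_ord_recl /= mul1r subn0.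
by rewrite big1 ?addr0// => i _; rewrite mul0r.
Qed.

Let fps_mulDl : left_distributive fps_mul +%R.
Proof.
move=> a b c; apply/funext => n; rewrite /fps_mul/=.
transitivity (\sum_(i < n.+1) (a i * c (n - i)%N + b i * c (n - i)%N)).
  by apply: eq_bigr => i _; rewrite -mulrDl.
by rewrite big_split.
Qed.

Let fps_oner_neq0 : fps_one != 0.
Proof.
apply/eqP => /(congr1 (fun f : fps R => f 0%N)) /= h.
by move/eqP: h; rewrite oner_eq0.
Qed.

HB.instance Definition _ := GRing.Zmodule_isComNzRing.Build (fps R)
  fps_mulA fps_mulC fps_mul1 fps_mulDl fps_oner_neq0.

Lemma fps_mulE a b n : (a * b) n = \sum_(i < n.+1) a i * b (n - i)%N.
Proof. by []. Qed.

Lemma fps_addE a b n : (a + b) n = a n + b n.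
Proof. by []. Qed.

Lemma fps_oppE a n : (- a) n = - a n.
Proof. by []. Qed.

Lemma fps_oneE n : (1 : fps R) n = (n == 0%N)%:R.
Proof. by []. Qed.

Lemma fps_mul0E a b : (a * b) 0%N = a 0%N * b 0%N.
Proof. by rewrite fps_mulE big_ord1. Qed.

Definition fps_deriv a : fps R := pseries_diffs a.

Lemma fps_derivE a n : fps_deriv a n = n.+1%:R * a n.+1.
Proof. by []. Qed.

Lemma fps_derivM a b :
  fps_deriv (a * b) = fps_deriv a * b + a * fps_deriv b.
Proof.
apply/funext => n; rewrite fps_derivE fps_addE.
(* The truncation order is [n.+2] because coefficient [n] of a derivative uses coefficient
   [n.+1]. *)
have der c i : (i < n.+1)%N -> ((trunc n.+2 c)^`())`_i = fps_deriv c i.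
  by move=> ni; rewrite coef_deriv coef_poly ltnS ni fps_derivE mulr_natl.
have -> : (a * b) n.+1 = (trunc n.+2 a * trunc n.+2 b)`_n.+1.
  by rewrite coef_trunc_mul.
rewrite mulr_natl -coef_deriv derivM coefD !coefM.
congr (_ + _); apply: eq_bigr => i _.
- rewrite der// coef_poly; case: ifP => //.
  by rewrite (leq_ltn_trans (leq_subr _ _))// ltnS ltnW.
- by rewrite der ?ltnS ?leq_subr// coef_poly ltnW// ltnS ltn_ord.
Qed.

(** Course-of-values recursion through a list: each coefficient of the reciprocal depends on all
    earlier ones. The formula is meant for constant term 1. *)
Fixpoint fps_inv_prefix a (n : nat) : seq R :=
  if n is m.+1 then
    let s := fps_inv_prefix a m in
    rcons s ((m == 0%N)%:R - \sum_(i < m) s`_i * a (m - i)%N)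
  else [::].

Definition fps_inv a : fps R := fun n => (fps_inv_prefix a n.+1)`_n.

Let size_fps_inv_prefix a n : size (fps_inv_prefix a n) = n.
Proof. by elim: n => //= n IHn; rewrite size_rcons IHn. Qed.

Let nth_fps_inv_prefix a n i : (i < n)%N -> (fps_inv_prefix a n)`_i = fps_inv a i.
Proof.
elim: n => // n IHn; rewrite ltnS leq_eqVlt => /predU1P[->//|ilt].
by rewrite /= nth_rcons size_fps_inv_prefix ilt IHn.
Qed.

Lemma fps_mulV a : a 0%N = 1 -> a * fps_inv a = 1.
Proof.
move=> a0; rewrite mulrC; apply/funext => n; rewrite fps_mulE big_ord_recr /=.
rewrite subnn a0 mulr1 {2}/fps_inv /= nth_rcons size_fps_inv_prefix ltnn eqxx.
rewrite (eq_bigr (fun i : 'I_n => (fps_inv_prefix a n)`_i * a (n - i)%N)).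
  by rewrite addrC subrK.
by move=> i _; rewrite nth_fps_inv_prefix.
Qed.

Lemma fps_inv0 a : a 0%N = 1 -> fps_inv a 0%N = 1.
Proof.
move=> a0; have := congr1 (fun f : fps R => f 0%N) (fps_mulV a0).
by rewrite fps_mul0E a0 mul1r.
Qed.

(* Logarithmic derivative: when [a] is the exponential generating function of
   the moments, [n`!%:R * fps_dlog a n] is the cumulant of order [n.+1]. *)
Definition fps_dlog a : fps R := fps_deriv a * fps_inv a.

Lemma fps_dlogP a : a 0%N = 1 -> fps_deriv a = fps_dlog a * a.
Proof.
by move=> a0; rewrite /fps_dlog -mulrA (mulrC _ a) fps_mulV// mulr1.
Qed.

Lemma fps_dlog_uniq a l : a 0%N = 1 -> fps_deriv a = l * a -> l = fps_dlog a.
Proof. by move=> a0 al; rewrite /fps_dlog al -mulrA fps_mulV// mulr1. Qed.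

Lemma fps_dlogM a b : a 0%N = 1 -> b 0%N = 1 ->
  fps_dlog (a * b) = fps_dlog a + fps_dlog b.
Proof.
move=> a0 b0; apply/esym/fps_dlog_uniq; first by rewrite fps_mul0E a0 b0 mulr1.
rewrite fps_derivM (fps_dlogP a0) (fps_dlogP b0); ring.
Qed.

Lemma fps_dlog1 : fps_dlog 1 = 0.
Proof.
apply/esym/fps_dlog_uniq; first by rewrite fps_oneE.
by rewrite mul0r; apply/funext => n; rewrite fps_derivE mulr0.
Qed.

Lemma fps_dlogV a : a 0%N = 1 -> fps_dlog (fps_inv a) = - fps_dlog a.
Proof.
move=> a0; have a'0 := fps_inv0 a0.
have : fps_dlog (a * fps_inv a) = 0 by rewrite fps_mulV// fps_dlog1.
by rewrite fps_dlogM// => /eqP; rewrite addrC addr_eq0 => /eqP.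
Qed.

Definition fps_scale (t : R) a : fps R := fun n => t ^+ n * a n.

Lemma fps_scaleM t a b : fps_scale t (a * b) = fps_scale t a * fps_scale t b.
Proof.
apply/funext => n; rewrite /fps_scale fps_mulE mulr_sumr.
apply: eq_bigr => i _; rewrite mulrACA -exprD subnKC//.
by rewrite -ltnS.
Qed.

(** The chain rule gives one extra factor [t]; this is the homogeneity of the cumulant of order
    [n.+1]. *)
Lemma fps_dlog_scale t a n : a 0%N = 1 ->
  fps_dlog (fps_scale t a) n = t ^+ n.+1 * fps_dlog a n.
Proof.
move=> a0; pose l : fps R := fun n => t ^+ n.+1 * fps_dlog a n.
suff <- : l = fps_dlog (fps_scale t a) by [].
apply: fps_dlog_uniq; first by rewrite /fps_scale a0 mulr1.
apply/funext => m.
have -> : fps_deriv (fps_scale t a) m = t * fps_scale t (fps_deriv a) m.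
  by rewrite /fps_scale !fps_derivE exprS; ring.
rewrite (fps_dlogP a0) fps_scaleM !fps_mulE mulr_sumr.
by apply: eq_bigr => i _; rewrite /l /fps_scale exprS !mulrA.
Qed.

End FormalPowerSeries.

(** * Entire power series *)

Section Entire.
Local Open Scope classical_set_scope.
Local Open Scope ring_scope.
Context {R : realType}.
Implicit Types (a b c : fps R) (r x M : R).

(** Equivalent to an infinite radius of convergence; uniform bounds on the terms are easier to
    combine than convergence statements. *)
Definition entire a : Prop :=
  forall r, 0 <= r -> exists M, forall n, `|a n| * r ^+ n <= M.

Definition fps_eval a x : R := limn (pseries a x).

(** Lets a factor [n] be absorbed by doubling the radius. *)
Lemma natr_le_expr2 n : n%:R <= 2 ^+ n :> R.
Proof. by rewrite -natrX ler_nat ltnW// ltn_expl. Qed.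

Lemma entire_le a b : (forall n, `|b n| <= `|a n|) -> entire a -> entire b.
Proof.
move=> ba ea r r0; have [M aM] := ea _ r0; exists M => n.
by apply: le_trans (aM n); rewrite ler_wpM2r// exprn_ge0.
Qed.

Lemma entireN a : entire a -> entire (- a).
Proof. by apply: entire_le => n; rewrite fps_oppE normrN. Qed.

Lemma entireD a b : entire a -> entire b -> entire (a + b).
Proof.
move=> ea eb r r0; have [M aM] := ea _ r0; have [N bN] := eb _ r0.
exists (M + N) => n; rewrite (le_trans _ (lerD (aM n) (bN n)))//.
by rewrite -mulrDl ler_wpM2r ?exprn_ge0// ler_normD.
Qed.

Lemma entire_deriv a : entire a -> entire (fps_deriv a).
Proof.
move=> ea r r0; have [|M aM] := ea (2 * (r + 1)); first by lra.
exists M => n; apply: le_trans (aM n.+1).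
rewrite fps_derivE normrM normr_nat (mulrC n.+1%:R) -mulrA ler_wpM2l// exprMn.
rewrite ler_pM ?exprn_ge0 ?natr_le_expr2//.
apply: (@le_trans _ _ ((r + 1) ^+ n)); first by rewrite lerXn2r ?qualifE//=; lra.
by rewrite ler_weXn2l//; lra.
Qed.

(** The bounds at radius [2 * r] leave a factor [2^-n], which absorbs the [n.+1] terms of the Cauchy
    product. *)
Lemma entireM a b : entire a -> entire b -> entire (a * b).
Proof.
move=> ea eb r r0; have r20 : 0 <= 2 * r by lra.
have [M aM] := ea _ r20; have [N bN] := eb _ r20.
have M0 : 0 <= M by apply: le_trans (aM 0%N); rewrite expr0 mulr1.
have N0 : 0 <= N by apply: le_trans (bN 0%N); rewrite expr0 mulr1.
exists (2 * (M * N)) => n.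
have p2 : 0 < 2 ^+ n :> R by rewrite exprn_gt0.
rewrite -(ler_pM2r p2) -mulrA -exprMn (mulrC r) fps_mulE.
apply: le_trans (ler_wpM2r _ (ler_norm_sum _ _ _)) _; first exact: exprn_ge0.
rewrite mulr_suml (@le_trans _ _ (\sum_(i < n.+1) (M * N)))//.
  apply: ler_sum => i _; have ni : (i <= n)%N by rewrite -ltnS.
  have e : (2 * r) ^+ n = (2 * r) ^+ i * (2 * r) ^+ (n - i) by rewrite -exprD subnKC.
  rewrite normrM e mulrACA ler_pM// mulr_ge0 ?exprn_ge0//.
rewrite sumr_const card_ord -(mulr_natl (M * N)) [leRHS]mulrAC.
by rewrite ler_wpM2r ?mulr_ge0// -exprS natr_le_expr2.
Qed.

Lemma geometric_half_cvg M : (M / 2 ^+ n) @[n --> \oo] --> (0 : R).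
Proof.
rewrite (_ : (fun n => _) = geometric M 2^-1); last first.
  by apply/funext => n; rewrite /= exprVn.
by apply: cvg_geometric; rewrite gtr0_norm ?invf_lt1// ?ltr1n// invr_gt0.
Qed.

Lemma entire_cvg a x : entire a -> cvgn (pseries a x).
Proof.
move=> ea; have [|M aM] := ea (2 * `|x|); first by rewrite mulr_ge0.
apply: normed_cvg; apply: (@series_le_cvg _ _ (geometric M 2^-1)) => [n|n|n|].
- exact: normr_ge0.
- by rewrite /= mulr_ge0 ?exprn_ge0// (le_trans _ (aM 0%N))// mulr1.
- rewrite /= exprVn ler_pdivlMr ?exprn_gt0//.
  by apply: le_trans (aM n); rewrite normrM normrX exprMn mulrAC mulrA.
- by apply: is_cvg_geometric_series; rewrite gtr0_norm ?invf_lt1// ?ltr1n// invr_gt0.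
Qed.

Lemma fps_eval_cvg a x : entire a ->
  (\sum_(i < n) a i * x ^+ i) @[n --> \oo] --> fps_eval a x.
Proof.
move=> /(@entire_cvg _ x); rewrite /fps_eval.
by rewrite /pseries /series /=; under eq_fun do rewrite big_mkord.
Qed.

Lemma fps_eval_tail a M r x N : (forall n, `|a n| * (2 * r) ^+ n <= M) ->
  entire a -> `|x| <= r ->
  `|fps_eval a x - \sum_(i < N) a i * x ^+ i| <= 2 * M / 2 ^+ N.
Proof.
move=> aM ea xr; have r0 : 0 <= r by rewrite (le_trans _ xr).
have M0 : 0 <= M by rewrite (le_trans _ (aM 0%N))// mulr1.

(* Subtracting the geometric tail still to come makes the bound inductive. *)
have bnd n : `|\sum_(i < n + N) a i * x ^+ i - \sum_(i < N) a i * x ^+ i|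
    <= 2 * M / 2 ^+ N - 2 * M / 2 ^+ (n + N).
  elim: n => [|n IHn]; first by rewrite add0n !subrr normr0.
  rewrite addSn big_ord_recr /= addrAC (le_trans (ler_normD _ _))//.
  have : `|a (n + N)%N * x ^+ (n + N)| <= M / 2 ^+ (n + N).
    rewrite ler_pdivlMr ?exprn_gt0// (le_trans _ (aM (n + N)%N))//.
    rewrite normrM normrX exprMn -mulrA ler_wpM2l// mulrC ler_wpM2l ?exprn_ge0//.
    by rewrite lerXn2r ?qualifE/=.
  move=> /(lerD IHn) /le_trans; apply.
  rewrite exprS invfM le_eqVlt; apply/orP; left; apply/eqP.
  by field; rewrite !expf_neq0 ?pnatr_eq0.
have cvN : (\sum_(i < n + N) a i * x ^+ i) @[n --> \oo] --> fps_eval a x.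
  by have := fps_eval_cvg (x := x) ea; rewrite -(cvg_shiftn N).
have cvD : `|\sum_(i < n + N) a i * x ^+ i - \sum_(i < N) a i * x ^+ i|
    @[n --> \oo] --> `|fps_eval a x - \sum_(i < N) a i * x ^+ i|.
  by apply: cvg_norm; apply: cvgB => //; exact: cvg_cst.
rewrite -(cvg_lim _ cvD)//; apply: limr_le; first exact: cvgP cvD.
near=> n; apply: le_trans (bnd n) _.
by rewrite gerBl mulr_ge0 ?invr_ge0 ?exprn_ge0 ?mulr_ge0.
Unshelve. all: by end_near. Qed.

Lemma fps_eval_derive a x : entire a ->
  is_derive x (1 : R) (fps_eval a) (fps_eval (fps_deriv a) x).
Proof.
move=> ea; apply: (@pseries_snd_diffs _ _ (`|x| + 1)).
- exact: entire_cvg.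
- exact: entire_cvg (entire_deriv ea).
- exact: entire_cvg (entire_deriv (entire_deriv ea)).
- by rewrite [ltRHS]ger0_norm ?addr_ge0// ltrDl.
Qed.

Lemma fps_evalD a b x : entire a -> entire b ->
  fps_eval (a + b) x = fps_eval a x + fps_eval b x.
Proof.
move=> ea eb; apply: (cvg_lim (@Rhausdorff R)).
rewrite /pseries /series /=; under eq_fun do rewrite big_mkord.
under eq_fun do (under eq_bigr do rewrite fps_addE mulrDl; rewrite big_split).
by apply: cvgD; exact: fps_eval_cvg.
Qed.

Lemma fps_evalN a x : entire a -> fps_eval (- a) x = - fps_eval a x.
Proof.
move=> ea; apply: (cvg_lim (@Rhausdorff R)).
rewrite /pseries /series /=; under eq_fun do rewrite big_mkord.
under eq_fun do (under eq_bigr do rewrite fps_oppE mulNr; rewrite sumrN).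
by apply: cvgN; exact: fps_eval_cvg.
Qed.

Lemma fps_eval0 a : entire a -> fps_eval a 0 = a 0%N.
Proof.
move=> ea; apply: (cvg_lim (@Rhausdorff R)).
rewrite -(cvg_shiftn 1) /= (_ : (fun n => _) = cst (a 0%N)); last first.
  apply/funext => n; rewrite /pseries /series /= addn1 big_nat_recl//= expr0 mulr1.
  by rewrite big1 ?addr0// => i _; rewrite exprS mul0r mulr0.
exact: cvg_cst.
Qed.

(** Only the indices of the square with [i + j >= N] survive: at most [N^2] terms of size at most
    [M / 8^N], and [N^2 <= 4^N]. This compares a product of partial sums with the partial sum of the
    Cauchy product. *)
Lemma triangle_sum_sub (w : nat -> nat -> R) M N :
  (forall i j, `|w i j| <= M / 8 ^+ (i + j)) ->
  `|\sum_(i < N) \sum_(j < N) w i j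
    - \sum_(n < N) \sum_(i < n.+1) w i (n - i)%N| <= M / 2 ^+ N.
Proof.
move=> wM; have M0 : 0 <= M.
  by rewrite -[M]divr1 -(expr0 8) (le_trans _ (wM 0%N 0%N)).
have -> : \sum_(n < N) \sum_(i < n.+1) w i (n - i)%N
    = \sum_(i < N) \sum_(j < N) (if (i + j < N)%N then w i j else 0).
  transitivity (\sum_(n < N) \sum_(i < N) \sum_(j < N)
      (if (i + j)%N == n then w i j else 0)).
    apply: eq_bigr => n _.
    rewrite (big_ord_widen _ (fun i => w i (n - i)%N) (ltn_ord n)) big_mkcond.
    apply: eq_bigr => i _; rewrite -big_mkcond /=; case: ifPn => [|] ni.
      have niN : (n - i < N)%N by rewrite (leq_ltn_trans (leq_subr _ _)).
      rewrite (big_pred1 (Ordinal niN))// => j.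
      by rewrite -[RHS]/((j == n - i :> nat)%N) -[RHS](eqn_add2l i) subnKC.
    rewrite big_pred0// => j; apply/negbTE; apply: contraNN ni => /eqP <-.
    by rewrite ltnS leq_addr.
  rewrite exchange_big; apply: eq_bigr => i _ /=.
  rewrite exchange_big; apply: eq_bigr => j _ /=.
  rewrite -big_mkcond; case: ifPn => ijN.
    by rewrite (big_pred1 (Ordinal ijN))// => k;
      rewrite -[RHS]/((k == i + j :> nat)%N) eq_sym.
  rewrite big_pred0// => k; apply/negbTE; apply: contraNN ijN => /eqP ->.
  exact: ltn_ord.
rewrite -sumrB (le_trans (ler_norm_sum _ _ _))//.
apply: (@le_trans _ _ (\sum_(i < N) \sum_(j < N) M / 8 ^+ N)).
  apply: ler_sum => i _; rewrite -sumrB (le_trans (ler_norm_sum _ _ _))//.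
  apply: ler_sum => j _; case: ifPn => [_|].
    by rewrite subrr normr0 mulr_ge0// invr_ge0 exprn_ge0.
  rewrite -leqNgt subr0 => Nij; apply: le_trans (wM _ _) _.
  by rewrite ler_wpM2l// lef_pV2 ?posrE ?exprn_gt0// ler_weXn2l// ler1n.
rewrite !sumr_const !card_ord -mulrnA -(mulr_natl (M / 8 ^+ N)) mulrCA.
rewrite ler_wpM2l// ler_pdivrMr ?exprn_gt0// mulrC ler_pdivlMr ?exprn_gt0//.
have -> : 8 = 2 * 2 * 2 :> R by ring.
by rewrite !exprMn ler_wpM2r ?exprn_ge0// natrM ler_pM ?natr_le_expr2.
Qed.

Lemma fps_evalM a b x : entire a -> entire b ->
  fps_eval (a * b) x = fps_eval a x * fps_eval b x.
Proof.
(* The radius [8 * |x|] yields the decay rate required by [triangle_sum_sub]. *)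
move=> ea eb; have r0 : 0 <= 8 * `|x| by rewrite mulr_ge0.
have [M aM] := ea _ r0; have [N bN] := eb _ r0.
pose A n := \sum_(i < n) a i * x ^+ i; pose B n := \sum_(i < n) b i * x ^+ i.
pose C n := \sum_(i < n) (a * b) i * x ^+ i.
have cA : A n @[n --> \oo] --> fps_eval a x by exact: fps_eval_cvg.
have cB : B n @[n --> \oo] --> fps_eval b x by exact: fps_eval_cvg.
have cC : C n @[n --> \oo] --> fps_eval (a * b) x.
  by apply: fps_eval_cvg; exact: entireM.
have bnd n : `|A n * B n - C n| <= (M * N) / 2 ^+ n.
  pose w i j := a i * x ^+ i * (b j * x ^+ j).
  have := @triangle_sum_sub w (M * N) n; rewrite /A /B /C.
  have -> : \sum_(i < n) \sum_(j < n) w i j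
      = (\sum_(i < n) a i * x ^+ i) * \sum_(i < n) b i * x ^+ i.
    by rewrite mulr_suml; apply: eq_bigr => i _; rewrite mulr_sumr.
  have -> : \sum_(k < n) \sum_(i < k.+1) w i (k - i)%N
      = \sum_(i < n) (a * b) i * x ^+ i.
    apply: eq_bigr => k _; rewrite fps_mulE mulr_suml; apply: eq_bigr => i _.
    by rewrite /w mulrACA -exprD subnKC// -ltnS.
  apply=> i j; rewrite ler_pdivlMr ?exprn_gt0//.
  have := ler_pM _ _ (aM i) (bN j); rewrite !mulr_ge0 ?exprn_ge0// => /(_ _ _).
  move=> h; apply: le_trans (h isT isT).
  rewrite /w !normrM !normrX !exprMn exprD le_eqVlt; apply/orP; left; apply/eqP.
  ring.
have cD : (A n * B n - C n) @[n --> \oo] --> (0 : R).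
  apply/norm_cvg0P; apply: squeeze_cvgr (cvg_cst 0) (geometric_half_cvg (M * N)).
  by near=> n; rewrite normr_ge0 bnd.
have cE : (A n * B n - C n) @[n --> \oo]
    --> fps_eval a x * fps_eval b x - fps_eval (a * b) x.
  by apply: cvgB => //; exact: cvgM.
apply/esym/eqP; rewrite -subr_eq0 -(cvg_lim (@Rhausdorff R) cE).
by rewrite (cvg_lim (@Rhausdorff R) cD).
Unshelve. all: by end_near. Qed.

End Entire.

(** * Real and imaginary parts of a series on a ray *)

Section Polar.
Context {R : realType}.
Implicit Types (a b l : fps R) (r x t alpha : R).

(* [fps_eval (cos_part t a) r] and [fps_eval (sin_part t a) r] are the real and
   imaginary parts of the value of the power series [a] at [r * exp(i t)]. *)
Definition cos_part t a : fps R := fun n => a n * cos (n%:R * t).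

Definition sin_part t a : fps R := fun n => a n * sin (n%:R * t).

(** The primitive with zero constant term; applied to [fps_dlog a] it is the logarithm of [a]. *)
Definition fps_int l : fps R := fun n => if n is m.+1 then l m / m.+1%:R else 0.

Lemma fps_intK l : fps_deriv (fps_int l) = l.
Proof. by apply/funext => n; rewrite fps_derivE /= mulrCA mulfV ?mulr1. Qed.

Lemma entire_int l : entire l -> entire (fps_int l).
Proof.
move=> el r r0; have [M lM] := el _ r0.
have M0 : 0 <= M by rewrite (le_trans _ (lM 0%N))// mulr1.
exists (M * r) => -[|n] /=; first by rewrite normr0 mul0r mulr_ge0.
rewrite exprSr mulrA ler_wpM2r// (le_trans _ (lM n))// ler_wpM2r ?exprn_ge0//.
by rewrite normrM ler_piMr// normfV normr_nat invf_le1// ler1n.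
Qed.

Lemma entire_cos_part t a : entire a -> entire (cos_part t a).
Proof.
apply: entire_le => n; rewrite normrM ler_piMr//.
by rewrite ler_norml cos_geN1 cos_le1.
Qed.

Lemma entire_sin_part t a : entire a -> entire (sin_part t a).
Proof.
apply: entire_le => n; rewrite normrM ler_piMr//.
by rewrite ler_norml sin_geN1 sin_le1.
Qed.

Lemma cos_part0 a : cos_part 0 a = a.
Proof. by apply/funext => n; rewrite /cos_part mulr0 cos0 mulr1. Qed.

Lemma sin_part0 a : sin_part 0 a = 0.
Proof. by apply/funext => n; rewrite /sin_part mulr0 sin0 mulr0. Qed.

(** With [a = exp g], this is [|a(z)|^2 = exp(2 Re g(z))] at [z = r exp(it)]. The quotient [F] of
    the two sides has zero derivative along the ray and equals 1 at the origin. *)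
Lemma expR_polar a l r t : entire a -> entire l -> a 0%N = 1 ->
    fps_deriv a = l * a ->
  fps_eval (cos_part t a) r ^+ 2 + fps_eval (sin_part t a) r ^+ 2
  = expR (2 * fps_eval (cos_part t (fps_int l)) r).
Proof.
move=> ea el a0 al.
(* Real and imaginary parts of [exp(it) l(z)]: differentiating in the radius brings out the factor
   [exp(it)], hence the angle [n.+1%:R * t]. *)
pose lc : fps R := fun n => l n * cos (n.+1%:R * t).
pose ls : fps R := fun n => l n * sin (n.+1%:R * t).
have elc : entire lc.
  apply: entire_le el => n; rewrite normrM ler_piMr//.
  by rewrite ler_norml cos_geN1 cos_le1.
have els : entire ls.
  apply: entire_le el => n; rewrite normrM ler_piMr//.
  by rewrite ler_norml sin_geN1 sin_le1.
have ec := entire_cos_part t ea; have es := entire_sin_part t ea.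
have eg := entire_cos_part t (entire_int el).
have ang n (i : 'I_n.+1) : n.+1%:R * t = i.+1%:R * t + (n - i)%:R * t.
  by rewrite -mulrDl -natrD addSn subnKC// -ltnS.
have dc : fps_deriv (cos_part t a)
    = lc * cos_part t a - ls * sin_part t a.
  apply/funext => n; rewrite fps_derivE /cos_part mulrA -fps_derivE al.
  rewrite fps_addE fps_oppE !fps_mulE mulr_suml -sumrB.
  by apply: eq_bigr => i _; rewrite (ang n i) cosD /lc /ls /sin_part; ring.
have ds : fps_deriv (sin_part t a)
    = ls * cos_part t a + lc * sin_part t a.
  apply/funext => n; rewrite fps_derivE /sin_part mulrA -fps_derivE al.
  rewrite fps_addE !fps_mulE mulr_suml -big_split/=.
  by apply: eq_bigr => i _; rewrite (ang n i) sinD /lc /ls /cos_part; ring.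
have dg : fps_deriv (cos_part t (fps_int l)) = lc.
  by apply/funext => n; rewrite fps_derivE /cos_part mulrA -fps_derivE fps_intK.
pose C := fps_eval (cos_part t a); pose S := fps_eval (sin_part t a).
pose G := fps_eval (cos_part t (fps_int l)).
have Cd x : is_derive x (1 : R) C (fps_eval lc x * C x - fps_eval ls x * S x).
  have := fps_eval_derive x ec; rewrite dc fps_evalD ?fps_evalN ?fps_evalM//.
    exact: entireM.
  - exact: entireM.
  - by apply/entireN/entireM.
have Sd x : is_derive x (1 : R) S (fps_eval ls x * C x + fps_eval lc x * S x).
  have := fps_eval_derive x es; rewrite ds fps_evalD ?fps_evalM//.
  - exact: entireM.
  - exact: entireM.
have Gd x : is_derive x (1 : R) G (fps_eval lc x).
  by have := fps_eval_derive x eg; rewrite dg.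
pose F x := (C x * C x + S x * S x) * expR (-2 * G x).
have Fd x : is_derive x (1 : R) F 0.
  have Hd : is_derive x (1 : R) (expR \o ((-2) \*: G))
      (expR (-2 * G x) * (-2 *: fps_eval lc x)).
    by apply: is_derive1_comp.
  have Nd := is_deriveM (is_deriveD (is_deriveM (Cd x) (Cd x))
    (is_deriveM (Sd x) (Sd x))) Hd.
  apply: is_derive_eq Nd _; rewrite /GRing.scale/=.
  rewrite -[(C * C + S * S) x]/(C x * C x + S x * S x).
  by rewrite -[expR (_ *: _)]/(expR (-2 * G x)); ring.
have := is_derive_0_is_cst r 0 Fd.
rewrite /F /C /S /G !fps_eval0// /cos_part /sin_part /= !mul0r cos0 sin0 a0.
rewrite !mulr0 expR0 !mulr1 addr0 mulNr expRN.
move/(canRL (mulfK _)); rewrite invr_eq0 gt_eqF ?expR_gt0// => /(_ isT).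
by rewrite invrK mul1r -!expr2.
Qed.

Lemma polar_angle (u v : R) : u ^+ 2 + v ^+ 2 = 1 ->
  exists alpha, cos alpha = u /\ sin alpha = v.
Proof.
move=> uv; have v2 : v ^+ 2 = 1 - u ^+ 2 by rewrite -uv addrC addKr.
have u1 : -1 <= u <= 1.
  rewrite -ler_norml -(@expr_le1 _ 2)// real_normK ?num_real//.
  by rewrite -subr_ge0 -v2 sqr_ge0.
have cu : cos (acos u) = u by rewrite acosK.
have su : sin (acos u) = `|v| by rewrite sin_acos// -v2 sqrtr_sqr.
have [v0|v0] := leP 0 v; first by exists (acos u); rewrite cu su ger0_norm.
by exists (- acos u); rewrite cosN sinN cu su ltr0_norm// opprK.
Qed.

End Polar.

(** * Series with a positive moment functional *)

Section PositiveMoments.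
Local Open Scope classical_set_scope.
Local Open Scope ring_scope.
Context {R : realType}.
Implicit Types (a : fps R) (r x t alpha : R).

Lemma sum_bin_recl (n : nat) (f : nat -> R) :
  \sum_(i < n.+2) 'C(n.+1, i)%:R * f i
  = \sum_(i < n.+1) 'C(n, i)%:R * f i + \sum_(i < n.+1) 'C(n, i)%:R * f i.+1.
Proof.
rewrite big_ord_recl /= bin0.
under eq_bigr do rewrite /bump /= add1n binS natrD mulrDl.
rewrite big_split /= addrA; congr (_ + _).
rewrite big_ord_recr /= bin_small// mul0r addr0 [RHS]big_ord_recl bin0.
by congr (_ + _); apply: eq_bigr => i _.
Qed.

(** The real part of [(exp(it) + exp(-it))^n * exp(i phi)]; the free phase [phi] is what makes the
    induction work. *)
Lemma sum_bin_cos (n : nat) t phi :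
  \sum_(i < n.+1) 'C(n, i)%:R * cos (i%:R * t - (n - i)%:R * t + phi)
  = (2 * cos t) ^+ n * cos phi.
Proof.
elim: n phi => [|n IHn] phi.
  by rewrite big_ord1 bin0 !mul0r subr0 add0r expr0.
rewrite (sum_bin_recl n (fun i => cos (i%:R * t - (n.+1 - i)%:R * t + phi))).
transitivity (\sum_(i < n.+1) 'C(n, i)%:R * cos (i%:R * t - (n - i)%:R * t + (phi - t))
    + \sum_(i < n.+1) 'C(n, i)%:R * cos (i%:R * t - (n - i)%:R * t + (phi + t))).
  congr (_ + _); apply: eq_bigr => i _; congr (_ * cos _).
    rewrite subSn; last by rewrite -ltnS.
    by rewrite -[(n - i).+1]addn1 natrD; ring.
  by rewrite subSS -[i.+1]addn1 natrD; ring.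
by rewrite !IHn cosB cosD exprS; ring.
Qed.

Definition pos_moments a : Prop := forall (N : nat) (q : nat -> R),
  0 <= \sum_(i < N) \sum_(j < N) q i * q j * ((i + j)`!%:R * a (i + j)%N).

(* Positivity is applied to the truncations of the square of
   [s |-> expR (x * s / 2) * sin (y * s / 2 - alpha / 2)], where [x], [y] are
   the Cartesian coordinates of [r * exp(i t)]: this square is half of
   [expR (x * s) * (1 - cos (y * s - alpha))]. *)
Lemma polar_le a r t alpha : entire a -> pos_moments a ->
  fps_eval (cos_part t a) r * cos alpha + fps_eval (sin_part t a) r * sin alpha
  <= fps_eval a (r * cos t).
Proof.
move=> ea pa; have [|M aM] := ea (8 * `|r|); first by rewrite mulr_ge0.
pose q (i : nat) : R := (r / 2) ^+ i * sin (i%:R * t - alpha / 2) / i`!%:R.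
pose w i j := q i * q j * ((i + j)`!%:R * a (i + j)%N).
have f0 k : k`!%:R != 0 :> R by rewrite pnatr_eq0 -lt0n fact_gt0.
have binE i j : (i + j)`!%:R / (i`!%:R * j`!%:R) = 'C(i + j, i)%:R :> R.
  by rewrite -[in LHS](bin_fact (leq_addr j i)) addKn !natrM mulfK// mulf_neq0.
have wE i j : w i j = 'C(i + j, i)%:R * (a (i + j)%N * (r / 2) ^+ (i + j))
    * (sin (i%:R * t - alpha / 2) * sin (j%:R * t - alpha / 2)).
  by rewrite -binE /w /q exprD; field; rewrite !f0.
have wM i j : `|w i j| <= M / 8 ^+ (i + j).
  rewrite ler_pdivlMr ?exprn_gt0// (le_trans _ (aM (i + j)%N))//.
  rewrite wE 3!normrM (normrM (sin _)).
  have -> : `|(r / 2) ^+ (i + j)| = `|r| ^+ (i + j) / 2 ^+ (i + j).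
    by rewrite normrX normrM normfV normr_nat exprMn exprVn.
  have C2 : `|'C(i + j, i)%:R| <= 2 ^+ (i + j) :> R.
    rewrite normr_nat -natrX ler_nat -[X in (_ <= X ^ _)%N]/(1 + 1)%N.
    rewrite expnDn; have ij : (i < (i + j).+1)%N by rewrite ltnS leq_addr.
    by rewrite (bigD1 (Ordinal ij))//= !exp1n !muln1 leq_addr.
  have s1 x y : `|sin x| * `|sin y| <= 1 :> R.
    by rewrite mulr_ile1// ler_norml sin_geN1 sin_le1.
  apply: (@le_trans _ _ (2 ^+ (i + j) * (`|a (i + j)%N|
      * (`|r| ^+ (i + j) / 2 ^+ (i + j))) * 1 * 8 ^+ (i + j))).
    rewrite ler_wpM2r ?exprn_ge0// ler_pM ?mulr_ge0 ?invr_ge0 ?exprn_ge0//.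
    by rewrite ler_wpM2r// ?mulr_ge0 ?invr_ge0 ?exprn_ge0.
  rewrite exprMn le_eqVlt; apply/orP; left; apply/eqP.
  by field; rewrite expf_neq0 ?pnatr_eq0.
pose U n := \sum_(k < n) a k * (r * cos t) ^+ k.
pose C n := \sum_(k < n) cos_part t a k * r ^+ k.
pose S n := \sum_(k < n) sin_part t a k * r ^+ k.
pose D n := (U n - (C n * cos alpha + S n * sin alpha)) / 2.
(* On the diagonal [i + j = k] the product of sines splits into two cosines: one sums to
   [(2 cos t)^k] by [sum_bin_cos], the other is constant and has total weight [2^k]. *)
have TE n : \sum_(k < n) \sum_(i < k.+1) w i (k - i)%N = D n.
  rewrite /D /U /C /S !mulr_suml -big_split -sumrB mulr_suml /=.
  apply: eq_bigr => k _.
  transitivity (\sum_(i < k.+1) a k * (r / 2) ^+ k / 2 *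
      ('C(k, i)%:R * cos (i%:R * t - (k - i)%:R * t + 0)
       - 'C(k, i)%:R * cos (k%:R * t - alpha))).
    apply: eq_bigr => i _; have ik : (i <= k)%N by rewrite -ltnS.
    rewrite wE subnKC// addr0.
    set u := i%:R * t - alpha / 2; set v := (k - i)%:R * t - alpha / 2.
    have -> : i%:R * t - (k - i)%:R * t = u - v by rewrite /u /v; ring.
    have -> : k%:R * t - alpha = u + v.
      by rewrite /u /v -{1}(subnKC ik) natrD; field.
    by clearbody u v; rewrite cosB cosD; field.
  rewrite -mulr_sumr sumrB sum_bin_cos cos0 mulr1 -mulr_suml.
  have -> : \sum_(i < k.+1) 'C(k, i)%:R = 2 ^+ k :> R.
    rewrite -natr_sum -natrX; congr (_%:R).
    by rewrite -[in RHS](addn1 1) expnDn; apply: eq_bigr => i _; rewrite !exp1n !muln1.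
  rewrite cosB !exprMn exprVn /cos_part /sin_part; field.
  by rewrite expf_neq0 ?pnatr_eq0.
(* The sum over the square is nonnegative by positivity, and [D n], the sum over the triangle,
   differs from it by at most [M / 2^n]. *)
have D_ge n : - (M / 2 ^+ n) <= D n.
  have := triangle_sum_sub n wM; rewrite TE ler_distl => /andP[_ h].
  by have := le_trans (pa n q) h; rewrite -lerBlDr sub0r.
have cD : D n @[n --> \oo] --> (fps_eval a (r * cos t)
    - (fps_eval (cos_part t a) r * cos alpha
       + fps_eval (sin_part t a) r * sin alpha)) / 2.
  apply: cvgMl; apply: cvgB; first exact: fps_eval_cvg.
  apply: cvgD; apply: cvgMl; apply: fps_eval_cvg.
    exact: entire_cos_part.
  exact: entire_sin_part.
have cM : - (M / 2 ^+ n) @[n --> \oo] --> (0 : R).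
  by rewrite -oppr0; apply: cvgN; exact: geometric_half_cvg.
have := ler_lim (cvgP _ cM) (cvgP _ cD).
rewrite (cvg_lim (@Rhausdorff R) cM) (cvg_lim (@Rhausdorff R) cD) => h.
rewrite -subr_ge0 -(pmulr_lge0 _ (_ : 0 < 2^-1)) ?invr_gt0//; apply: h.
by near=> n; exact: D_ge.
Unshelve. all: by end_near. Qed.

(** This is [|a(z)| <= a(Re z)], squared: in [polar_le], take for [alpha] the argument of [a(z)]. *)
Lemma polar_norm_le a r t : entire a -> pos_moments a ->
  fps_eval (cos_part t a) r ^+ 2 + fps_eval (sin_part t a) r ^+ 2
  <= fps_eval a (r * cos t) ^+ 2.
Proof.
move=> ea pa; set u := fps_eval _ r; set v := fps_eval _ r.
set F := fps_eval a _.
have [uv0|uv0] := eqVneq (u ^+ 2 + v ^+ 2) 0; first by rewrite uv0 sqr_ge0.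
have uv : 0 < u ^+ 2 + v ^+ 2 by rewrite lt_neqAle eq_sym uv0 addr_ge0 ?sqr_ge0.
set s := Num.sqrt (u ^+ 2 + v ^+ 2).
have s0 : 0 < s by rewrite sqrtr_gt0.
have s2 : s ^+ 2 = u ^+ 2 + v ^+ 2 by rewrite sqr_sqrtr// ltW.
have [|alpha [ca sa]] := @polar_angle R (u / s) (v / s).
  by rewrite !expr_div_n -mulrDl -s2 mulfV// s2.
have := @polar_le a r t alpha ea pa; rewrite ca sa -/u -/v -/F.
have -> : u * (u / s) + v * (v / s) = s.
  by rewrite !mulrA -mulrDl -!expr2 -s2 expr2 mulfK// gt_eqF.
by move=> sF; rewrite -s2 lerXn2r// qualifE/= ?(le_trans _ sF)// ltW.
Qed.

(** At [t = 0] and [alpha = pi], [polar_le] reads [- a(x) <= a(x)]. *)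
Lemma fps_eval_ge0 a x : entire a -> pos_moments a -> 0 <= fps_eval a x.
Proof.
move=> ea pa; have h1 := @polar_le a x 0 0 ea pa.
have h2 := @polar_le a x 0 pi ea pa.
move: h1 h2; rewrite cos_part0 cospi sinpi sin0 cos0 !mulr1 !mulr0 !addr0.
by lra.
Qed.

End PositiveMoments.

(** * Entire series whose real part is bounded above *)

Section RealPartBound.
Local Open Scope classical_set_scope.
Local Open Scope ring_scope.
Context {R : realType}.
Implicit Types (a g : fps R) (r x t : R).

Lemma fps_eval_fin a m x : (forall n, (m < n)%N -> a n = 0) ->
  fps_eval a x = \sum_(i < m.+1) a i * x ^+ i.
Proof.
move=> am; apply: (cvg_lim (@Rhausdorff R)).
rewrite -(cvg_shiftn m.+1) /= (_ : (fun n => _) = cst (\sum_(i < m.+1) a i * x ^+ i)).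
  exact: cvg_cst.
apply/funext => n; rewrite /pseries /series /= big_mkord addnC.
elim: n => [|n IHn]; first by rewrite addn0.
by rewrite addnS big_ord_recr /= IHn am ?mul0r ?addr0// ltnS leq_addr.
Qed.

Lemma sin_add_natmul2pi x n : sin (x + n%:R * (2 * pi)) = sin x.
Proof.
by rewrite mulr_natl mulr_natl (periodicn (@sinD2pi R)).
Qed.

(** Multiplied by [2 * sin x], where [2 * x] is the step of the angle, the sum telescopes over a
    whole number of periods; [0 < m < Q] makes [sin x] positive. *)
Lemma sum_cos_roots (Q m : nat) : (0 < m < Q)%N ->
  \sum_(j < Q) cos (m%:R * (2 * pi * j%:R / Q%:R)) = 0 :> R.
Proof.
case/andP=> m0 mQ; have Q0 : 0 < Q%:R :> R by rewrite ltr0n (leq_trans _ mQ).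
have Qn0 : Q%:R != 0 :> R by rewrite gt_eqF.
pose x : R := m%:R * pi / Q%:R.
have sx : 0 < sin x.
  have m0' : 0 < m%:R :> R by rewrite ltr0n.
  apply: sin_gt0_pi; rewrite divr_gt0 ?mulr_gt0 ?pi_gt0//=.
  by rewrite ltr_pdivrMr// mulrC ltr_pM2l ?pi_gt0// ltr_nat.
suff : 2 * sin x * \sum_(j < Q) cos (m%:R * (2 * pi * j%:R / Q%:R)) = 0.
  by move/eqP; rewrite mulf_eq0 mulf_eq0 pnatr_eq0/= (gt_eqF sx)/= => /eqP.
pose f (j : nat) := sin ((2 * j%:R - 1) * x).
rewrite mulr_sumr (eq_bigr (fun j : 'I_Q => f j.+1 - f j)); last first.
  move=> j _; rewrite /f -(natr1 j).
  have -> : (2 * (j%:R + 1) - 1) * x = 2 * j%:R * x + x by ring.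
  have -> : (2 * j%:R - 1) * x = 2 * j%:R * x - x by ring.
  have -> : m%:R * (2 * pi * j%:R / Q%:R) = 2 * j%:R * x by rewrite /x; field.
  by rewrite sinD sinB; ring.
rewrite -(big_mkord xpredT (fun j => f j.+1 - f j)) telescope_sumr//.
have -> : f Q = f 0%N; last by rewrite subrr.
rewrite /f mulr0 -[RHS](sin_add_natmul2pi _ m); congr sin.
by rewrite /x; field.
Qed.

(** Borel-Caratheodory by finite averages: [H] minus the real part is averaged over roots of unity
    with the nonnegative weights [1 + s * cos(n T)], which isolate [s * g n * r^n / 2]. The choices
    [s = 1] and [s = -1] bound the absolute value. *)
Lemma real_part_coef_bound g H r n : entire g -> g 0%N = 0 -> 0 <= r ->
    (forall t, fps_eval (cos_part t g) r <= H) -> (0 < n)%N ->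
  `|g n| * r ^+ n <= 2 * H.
Proof.
move=> eg g0 r0 gH n0; have [|M gM] := eg (2 * r); first by rewrite mulr_ge0.
have main N (s : R) : (n < N)%N -> `|s| <= 1 ->
    s * (g n * r ^+ n) <= 2 * (H + 2 * M / 2 ^+ N).
  (* With [Q = N + n] sample points, all frequencies [k + n] and [|k - n|] with [k < N] stay below
     [Q], so distinct ones do not alias. *)
  move=> nN s1; set Q := (N + n)%N.
  have Q0 : 0 < Q%:R :> R by rewrite ltr0n addn_gt0 n0 orbT.
  pose T (j : nat) : R := 2 * pi * j%:R / Q%:R.
  pose E (m : nat) : R := \sum_(j < Q) cos (m%:R * T j).
  have E0 : E 0%N = Q%:R.
    rewrite /E; under eq_bigr do rewrite mul0r cos0.
    by rewrite sumr_const card_ord.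
  have Em m : (0 < m < Q)%N -> E m = 0 by exact: sum_cos_roots.
  pose V t := \sum_(k < N) cos_part t g k * r ^+ k.
  have VH t : V t <= H + 2 * M / 2 ^+ N.
    have /(_ t) cM : forall t k, `|cos_part t g k| * (2 * r) ^+ k <= M.
      move=> t' k; apply: le_trans (gM k); rewrite ler_wpM2r ?exprn_ge0 ?mulr_ge0//.
      by rewrite normrM ler_piMr// ler_norml cos_geN1 cos_le1.
    have := fps_eval_tail N cM (entire_cos_part t eg) (_ : `|r| <= r).
    rewrite ger0_norm// lexx => /(_ isT); rewrite ler_distl => /andP[h _].
    by have := gH t; rewrite -/(V t) in h; move: h; lra.
  have pos : 0 <= \sum_(j < Q)
      (H + 2 * M / 2 ^+ N - V (T j)) * (1 + s * cos (n%:R * T j)).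
    apply: sumr_ge0 => j _; rewrite mulr_ge0 ?subr_ge0//.
    rewrite addrC -lerBlDr sub0r; have : `|s * cos (n%:R * T j)| <= 1.
      by rewrite normrM mulr_ile1// ler_norml cos_geN1 cos_le1.
    by rewrite ler_norml => /andP[].
  have S1 : \sum_(j < Q) (1 + s * cos (n%:R * T j)) = Q%:R.
    rewrite big_split /= sumr_const card_ord -mulr_sumr -/(E n) Em ?mulr0 ?addr0//.
    by rewrite n0 /Q -[ltnLHS]add0n ltn_add2r (leq_ltn_trans _ nN).
  have SV : \sum_(j < Q) V (T j) * (1 + s * cos (n%:R * T j))
      = Q%:R * (s * (g n * r ^+ n) / 2).
    transitivity (\sum_(k < N) g k * r ^+ k * (E k + s / 2 *
        (E (k + n)%N + E (maxn k n - minn k n)%N))).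
      under eq_bigr do rewrite mulr_suml.
      rewrite exchange_big /=; apply: eq_bigr => k _.
      rewrite /E -big_split /= mulr_sumr -big_split /= mulr_sumr.
      apply: eq_bigr => j _; rewrite /cos_part natrD mulrDl.
      have -> : cos ((maxn k n - minn k n)%:R * T j)
          = cos (k%:R * T j - n%:R * T j).
        case: (leqP k n) => kn; last by rewrite natrB ?mulrBl// ltnW.
        by rewrite natrB// mulrBl -cosN opprB.
      by rewrite cosD cosB; field.
    have nN' : (n < Q)%N by rewrite (leq_trans nN)// leq_addr.
    rewrite (bigD1 (Ordinal nN))//= maxnn minnn subnn E0 !Em ?n0//; last first.
      by rewrite addn_gt0 n0 /Q ltn_add2r.
    rewrite big1 ?addr0 => [|k kn]; first by rewrite add0r add0r; field.
    have [k0|k0] := posnP k; first by rewrite k0 g0 !mul0r.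
    have kn' : nat_of_ord k <> n by move=> e; move/eqP: kn; apply; exact: val_inj.
    have kN := ltn_ord k.
    have [e1 e2 e3] : [/\ 0 < k < Q, 0 < k + n < Q & 0 < maxn k n - minn k n < Q]%N.
      by rewrite /Q; clear -n0 nN k0 kN kn'; split; lia.
    by rewrite !Em// addr0 mulr0 addr0 mulr0.
  move: pos; under eq_bigr do rewrite mulrBl.
  rewrite sumrB -mulr_sumr S1 SV mulrC -mulrBr pmulr_rge0//.
  by move=> h; lra.
have lim_le (x y : R) :
    (forall N, (n < N)%N -> x <= 2 * (y + 2 * M / 2 ^+ N)) -> x <= 2 * y.
  move=> h; have cv : 2 * (y + 2 * M / 2 ^+ N) @[N --> \oo] --> 2 * (y + 0).
    by apply: cvgMr; apply: cvgD (geometric_half_cvg _); exact: cvg_cst.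
  rewrite -[y]addr0 -(cvg_lim (@Rhausdorff R) cv).
  apply: limr_ge; first by apply/cvg_ex; exists (2 * (y + 0)).
  by near=> N; apply: h; near: N; exact: nbhs_infty_gt.
apply: lim_le => N nN.
rewrite -[X in _ * X](ger0_norm (exprn_ge0 n r0)) -normrM.
rewrite ler_norml lerNl; apply/andP; split.
  by rewrite -mulN1r main// normrN1.
by rewrite -[leLHS]mul1r main// normr1.
Unshelve. all: by end_near. Qed.

Lemma real_part_degree g K D : entire g -> g 0%N = 0 ->
    (forall r t, 1 <= r -> fps_eval (cos_part t g) r <= K * r ^+ D) ->
  forall n, (D < n)%N -> g n = 0.
Proof.
move=> eg g0 gK n Dn; apply/eqP; rewrite -normr_eq0; apply/negPn/negP => gn0.
have gn : 0 < `|g n| by rewrite lt_neqAle eq_sym gn0 normr_ge0.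
have bnd r : 1 <= r -> `|g n| * r <= 2 * K.
  move=> r1; have r0 : 0 <= r by rewrite (le_trans _ r1).
  have rp k : 0 < r ^+ k by rewrite exprn_gt0// (lt_le_trans _ r1).
  have n0 := leq_ltn_trans (leq0n D) Dn.
  have := real_part_coef_bound eg g0 r0 (fun t => gK r t r1) n0.
  have -> : r ^+ n = r ^+ (n - D.+1) * r * r ^+ D.
    by rewrite -exprSr -exprD addSnnS subnK.
  rewrite !mulrA ler_pM2r//; apply: le_trans.
  by rewrite ler_wpM2r// ler_peMr// exprn_ege1.
have K0 : 0 <= K.
  by have := le_trans (mulr_ge0 (normr_ge0 _) ler01) (bnd _ (lexx 1)); lra.
(* At this radius the bound reads [|g n| + 2 * K <= 2 * K]. *)
have := bnd (1 + 2 * K / `|g n|); rewrite lerDl divr_ge0 ?mulr_ge0// => /(_ isT).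
by rewrite mulrDr mulr1 mulrCA mulfV// mulr1; lra.
Qed.

Lemma leading_coef_le0 (c : nat -> R) m :
    (forall r, 1 <= r -> \sum_(k < m.+1) c k * r ^+ k <= 0) -> c m <= 0.
Proof.
move=> cr; rewrite leNgt; apply/negP => cm.
case: m cr cm => [cr cm|m cr cm].
  by have := cr 1 (lexx 1); rewrite big_ord1 expr0 mulr1 leNgt cm.
pose C := \sum_(k < m.+1) `|c k|.
have C0 : 0 <= C by apply: sumr_ge0.
(* Chosen so that [c m.+1 * r - C = c m.+1]: the leading term then beats all lower ones. *)
pose r := 1 + C / c m.+1.
have r1 : 1 <= r by rewrite lerDl divr_ge0// ltW.
have rp k : 0 < r ^+ k by rewrite exprn_gt0// (lt_le_trans _ r1).
have low : - C * r ^+ m <= \sum_(k < m.+1) c k * r ^+ k.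
  rewrite mulNr lerNl /C mulr_suml -sumrN; apply: ler_sum => k _.
  rewrite (le_trans (ler_norm _))// normrN normrM normrX.
  rewrite (ger0_norm (le_trans ler01 r1)).
  by rewrite ler_wpM2l// ler_weXn2l// -ltnS.
have := cr _ r1; rewrite big_ord_recr /= => h.
have : (c m.+1 * r - C) * r ^+ m <= 0.
  by rewrite mulrBl -mulrA -exprS; move: low h; rewrite mulNr; lra.
rewrite pmulr_lle0// /r mulrDr mulr1 mulrCA mulfV ?gt_eqF// mulr1; lra.
Qed.

(* Marcinkiewicz' argument: for a nonzero leading term of degree [m > 2], the
   angles [pi / m] and [2 * pi / m] give the inequality opposite signs. *)
Lemma real_part_le_quadratic g D : entire g ->
    (forall r t, fps_eval (cos_part t g) r <= fps_eval g (r * cos t)) ->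
    (forall n, (D < n)%N -> g n = 0) ->
  forall n, (2 < n)%N -> g n = 0.
Proof.
move=> eg gle gD.
have step m : (2 < m)%N -> (forall n, (m < n)%N -> g n = 0) -> g m = 0.
  move=> m2 gm; have m0 : 0 < m%:R :> R by rewrite ltr0n (leq_trans _ m2).
  (* For a fixed angle, [Re g(r exp(it)) - g(r cos t)] is a polynomial in [r] that is never
     positive, so its leading coefficient is not positive either. *)
  have lead t : g m * (cos (m%:R * t) - cos t ^+ m) <= 0.
    apply: (@leading_coef_le0 (fun k => g k * (cos (k%:R * t) - cos t ^+ k))) => r _.
    have := gle r t; rewrite !(@fps_eval_fin _ m)//; last first.
      by move=> n mn; rewrite /cos_part gm// mul0r.
    rewrite -subr_le0 -sumrB; apply: le_trans; rewrite le_eqVlt; apply/orP; left.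
    by apply/eqP/eq_bigr => k _; rewrite /cos_part exprMn; ring.
  have cosX t : 0 < t -> t < pi -> `|cos t ^+ m| < 1 :> R.
    move=> t0 tpi; rewrite normrX exprn_ilt1 ?normr_ge0 -?lt0n ?(leq_trans _ m2)//.
    rewrite -(@expr_lt1 _ 2)// real_normK ?num_real// cos2sin2.
    by rewrite gtrBl exprn_gt0// sin_gt0_pi// t0 tpi.
  have pi0 := pi_gt0 R.
  apply/eqP; rewrite eq_le; apply/andP; split.
    (* Since [m > 2], this angle lies strictly below [pi], where [cosX] applies. *)
    have := lead (2 * pi / m%:R); rewrite [m%:R * _]mulrC divfK ?gt_eqF//.
    rewrite mulr_natl cos2pi pmulr_lle0// subr_gt0.
    have := cosX (2 * pi / m%:R); rewrite divr_gt0 ?mulr_gt0// => /(_ isT).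
    rewrite ltr_pdivrMr// [ltRHS]mulrC ltr_pM2r// ltr_nat => /(_ m2).
    by rewrite mulr_natl; apply: le_lt_trans; exact: ler_norm.
  have := lead (pi / m%:R); rewrite [m%:R * _]mulrC divfK ?gt_eqF//.
  rewrite cospi nmulr_lle0// subr_lt0.
  have := cosX (pi / m%:R); rewrite divr_gt0// => /(_ isT).
  rewrite ltr_pdivrMr// ltr_pMr// ltr1n (leq_trans _ m2)// => /(_ isT).
  by rewrite ltr_norml => /andP[].
(* Descending induction on the degree, starting above [D]; [d] measures how far [n] lies below. *)
have all_d d n : (2 < n)%N -> (D < n + d)%N -> g n = 0.
  elim: d n => [|d IHd] n n2; first by rewrite addn0 => /gD.
  move=> Dnd; apply: step => // k nk; apply: IHd; first exact: ltn_trans nk.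
  by rewrite (leq_trans Dnd)// addnS -addSn leq_add2r.
by move=> n n2; apply: (all_d D.+1) => //; rewrite addnS ltnS leq_addl.
Qed.

End RealPartBound.

(** * Cramer's decomposition argument for series with finitely many cumulants *)

Section Cramer.
Local Open Scope classical_set_scope.
Local Open Scope ring_scope.
Context {R : realType}.
Implicit Types (a b c l : fps R) (r x : R).

(** Positivity tested on the square of [x^n + s * x^(n+1)]. *)
Lemma pos_moments_pair a n (s : R) : pos_moments a ->
  0 <= (n.*2)`!%:R * a n.*2 + 2 * s * ((n.*2.+1)`!%:R * a n.*2.+1)
       + s ^+ 2 * ((n.*2.+2)`!%:R * a n.*2.+2).
Proof.
move=> pa; pose q (i : nat) : R := if i == n then 1 else if i == n.+1 then s else 0.
have qn : q n = 1 by rewrite /q eqxx.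
have qn1 : q n.+1 = s by rewrite /q eqn_leq ltnn eqxx.
have q0 (i : 'I_n) : q i = 0.
  by rewrite /q (ltn_eqF (ltn_ord i)) (ltn_eqF (ltnW _)) ?ltnS.
have row (F : nat -> R) : \sum_(i < n.+2) q i * F i = F n + s * F n.+1.
  rewrite !big_ord_recr /= qn qn1 mul1r big1 ?add0r// => i _.
  by rewrite q0 mul0r.
have := pa n.+2 q; congr (_ <= _).
transitivity (\sum_(i < n.+2) q i * ((i + n)`!%:R * a (i + n)%N
    + s * ((i + n.+1)`!%:R * a (i + n.+1)%N))).
  apply: eq_bigr => i _.
  rewrite -(row (fun j => (i + j)`!%:R * a (i + j)%N)) mulr_sumr.
  by apply: eq_bigr => j _; rewrite -mulrA.
rewrite (row (fun i => (i + n)`!%:R * a (i + n)%N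
    + s * ((i + n.+1)`!%:R * a (i + n.+1)%N))).
by rewrite !addSn !addnS addnn; ring.
Qed.

Lemma pos_moments_even a n : pos_moments a -> 0 <= a n.*2.
Proof.
move=> /(pos_moments_pair n 0); rewrite mulr0 mul0r expr0n mul0r !addr0.
by rewrite pmulr_rge0// ltr0n fact_gt0.
Qed.

(** Writing [m_k] for the moments, [s = 1] and [s = -1] give [2 |m_(2n+1)| <= m_(2n) + m_(2n+2)];
    dividing by the factorials produces the factor [n.+1]. *)
Lemma pos_moments_odd a n : pos_moments a ->
  `|a n.*2.+1| <= a n.*2 + n.+1%:R * a n.*2.+2.
Proof.
move=> pa; have f0 : 0 < (n.*2)`!%:R :> R by rewrite ltr0n fact_gt0.
have N0 : 0 <= (n.*2)%:R :> R by [].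
have := pos_moments_even n.+1 pa; have := pos_moments_even n pa.
rewrite doubleS => a0 a2.
have h1 := pos_moments_pair n 1 pa; have h2 := pos_moments_pair n (-1) pa.
move: h1 h2; rewrite !factS !natrM.
set y := a n.*2.+1; set x := a n.*2 in a0 *; set z := a n.*2.+2 in a2 *.
set f := (n.*2)`!%:R in f0 *.
have -> : n.*2.+2%:R = 2 * n.+1%:R :> R by rewrite -doubleS -mul2n natrM.
have n1 : 1 <= n.*2.+1%:R :> R by rewrite ler1n.
set k := n.*2.+1%:R in n1 *; set m := n.+1%:R => h1 h2.
have e1 : 0 <= f * (x + 2 * k * y + 2 * m * k * z) by move: h1; congr (_ <= _); ring.
have e2 : 0 <= f * (x - 2 * k * y + 2 * m * k * z) by move: h2; congr (_ <= _); ring.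
rewrite pmulr_rge0// in e1; rewrite pmulr_rge0// in e2.
have k0 : 0 < 2 * k by lra.
have xk : x <= 2 * k * x by rewrite ler_peMl//; lra.
rewrite ler_norml lerNl; apply/andP; split; rewrite -(ler_pM2l k0).
  by move: e1 xk; rewrite mulrN mulrDr; set u := 2 * k * y; lra.
by move: e2 xk; rewrite mulrDr; set u := 2 * k * y; lra.
Qed.

(** Even coefficients are nonnegative and dominated by those of [c]. Odd ones follow from
    [pos_moments_odd], whose factor [n.+1] is absorbed by a larger radius. *)
Lemma pos_moments_entire a c : pos_moments a ->
  (forall n, a n.*2 <= c n.*2) -> entire c -> entire a.
Proof.
move=> pa ac ec r r0; have [|M cM] := ec (2 * (r + 1)); first by lra.
have r1 : 1 <= r + 1 by rewrite lerDr.
have rX n : r ^+ n <= (r + 1) ^+ n by rewrite lerXn2r ?qualifE//=; lra.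
have even_le n : a n.*2 * (2 * (r + 1)) ^+ n.*2 <= M.
  apply: le_trans (cM n.*2); rewrite ler_wpM2r ?exprn_ge0//; first by lra.
  by rewrite (le_trans (ac n))// ler_norm.
have M0 : 0 <= M by apply: le_trans (cM 0%N); rewrite mulr1.
have even_le1 n : a n.*2 * (r + 1) ^+ n.*2 <= M.
  apply: le_trans (even_le n); rewrite ler_wpM2l ?pos_moments_even//.
  by rewrite lerXn2r ?qualifE//=; lra.
exists (M * (r + 1) + M) => k; rewrite -(odd_double_half k).
case: (odd k) => /=; rewrite ?add0n; set n := k./2; last first.
  rewrite ger0_norm ?pos_moments_even//.
  apply: le_trans (_ : a n.*2 * (r + 1) ^+ n.*2 <= _).
    by rewrite ler_wpM2l ?pos_moments_even.
  by rewrite (le_trans (even_le1 n))// lerDr mulr_ge0//; lra.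
rewrite add1n; apply: le_trans (ler_wpM2r _ (pos_moments_odd n pa)) _.
  exact: exprn_ge0.
rewrite mulrDl lerD//.
  apply: le_trans (_ : a n.*2 * (r + 1) ^+ n.*2.+1 <= _).
    by rewrite ler_wpM2l ?pos_moments_even.
  by rewrite exprSr mulrA ler_wpM2r//; lra.
have := even_le n.+1; rewrite doubleS; apply: le_trans.
rewrite (mulrC n.+1%:R) -mulrA ler_wpM2l -?doubleS ?pos_moments_even//.
rewrite exprMn ler_pM ?exprn_ge0//.
  apply: le_trans (natr_le_expr2 _) _.
  by rewrite ler_weXn2l ?ler1n// -addnn leq_addr.
apply: le_trans (rX _) _.
by rewrite ler_weXn2l// doubleS.
Qed.

Lemma entire_sum_le l r : entire l -> 0 <= r ->
  exists K, forall n, \sum_(i < n) `|l i| * r ^+ i <= K.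
Proof.
move=> el r0; have [|M lM] := el (2 * r); first by rewrite mulr_ge0.
have M0 : 0 <= M by apply: le_trans (lM 0%N); rewrite mulr1.
exists (2 * M) => n.
suff : \sum_(i < n) `|l i| * r ^+ i <= 2 * M - 2 * M / 2 ^+ n.
  by move/le_trans; apply; rewrite gerBl divr_ge0 ?exprn_ge0 ?mulr_ge0.
elim: n => [|n IHn]; first by rewrite big_ord0 divr1 subrr.
have h : `|l n| * r ^+ n <= M / 2 ^+ n.
  by rewrite ler_pdivlMr ?exprn_gt0// -mulrA -exprMn mulrC [r * 2]mulrC mulrC.
rewrite big_ord_recr /=; apply: le_trans (lerD IHn h) _.
rewrite le_eqVlt exprS; apply/orP; left; apply/eqP.
by field; rewrite expf_neq0 ?pnatr_eq0.
Qed.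

(** The equation is the recursion [(m+1) a_(m+1) = \sum_i l_i a_(m-i)]. If [K] bounds the sums of
    [|l i| r^i], then for [m >= r * K] it propagates any bound on the earlier terms; [M] covers the
    finitely many initial ones. *)
Lemma entire_of_deriv a l : entire l -> fps_deriv a = l * a -> entire a.
Proof.
move=> el al r r0; have [K lK] := entire_sum_le el r0.
have K0 : 0 <= K by have := lK 0%N; rewrite big_ord0.
pose N := (Num.truncn (r * K)).+1; have KN : r * K <= N%:R.
  by rewrite ltW// truncnS_gt.
pose M := \sum_(i < N.+1) `|a i| * r ^+ i.
have M0 : 0 <= M by apply: sumr_ge0 => i _; rewrite mulr_ge0 ?exprn_ge0.
exists M => n; elim/ltn_ind: n => n IHn.
have [nN|] := ltnP n N.+1.
  rewrite /M (bigD1 (Ordinal nN))//= lerDl sumr_ge0// => i _.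
  by rewrite mulr_ge0 ?exprn_ge0.
case: n IHn => // m IHn; rewrite ltnS => Nm.
have m0 : 0 < m.+1%:R :> R by rewrite ltr0n.
rewrite -(ler_pM2l m0) mulrA -[m.+1%:R]normr_nat -normrM -fps_derivE al.
rewrite normr_nat exprS fps_mulE.
apply: le_trans (ler_wpM2r _ (ler_norm_sum _ _ _)) _.
  by rewrite mulr_ge0 ?exprn_ge0.
apply: (@le_trans _ _ (r * K * M)); last first.
  rewrite ler_wpM2r// (le_trans KN)// ler_nat ltnW//.
have -> : (\sum_(i < m.+1) `|l i * a (m - i)%N|) * (r * r ^+ m)
   = r * \sum_(i < m.+1) `|l i| * r ^+ i * (`|a (m - i)%N| * r ^+ (m - i)).
  rewrite mulrCA; congr (_ * _); rewrite mulr_suml; apply: eq_bigr => i _.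
  have im : (i <= m)%N by rewrite -ltnS.
  by rewrite mulrACA -exprD subnKC// normrM.
rewrite -mulrA ler_wpM2l//.
apply: le_trans (_ : (\sum_(i < m.+1) `|l i| * r ^+ i) * M <= _).
  rewrite mulr_suml; apply: ler_sum => i _; rewrite ler_wpM2l ?mulr_ge0 ?exprn_ge0//.
  by apply: IHn; rewrite ltnS leq_subr.
by rewrite ler_wpM2r.
Qed.

Lemma entire_finite l D : (forall n, (D <= n)%N -> l n = 0) -> entire l.
Proof.
move=> lD r r0; exists (\sum_(i < D) `|l i| * r ^+ i) => n.
have [Dn|nD] := leqP D n.
  rewrite lD// normr0 mul0r; apply: sumr_ge0 => i _.
  by rewrite mulr_ge0 ?exprn_ge0.
rewrite (bigD1 (Ordinal nD))//= lerDl sumr_ge0// => i _.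
by rewrite mulr_ge0 ?exprn_ge0.
Qed.

(** Here [a = exp g] with [g] a polynomial of degree at most [D], and [K] is the sum of the absolute
    values of its coefficients. *)
Lemma fps_eval_le_exp a l D : a 0%N = 1 -> fps_deriv a = l * a ->
    (forall n, (D <= n)%N -> l n = 0) ->
  exists2 K, 0 <= K &
    forall r x, 1 <= r -> `|x| <= r -> fps_eval a x <= expR (K * r ^+ D).
Proof.
move=> a0 al lD; have el := entire_finite lD; have ea := entire_of_deriv el al.
pose g := fps_int l.
have gD n : (D < n)%N -> g n = 0.
  by case: n => //= n; rewrite ltnS => /lD ->; rewrite mul0r.
exists (\sum_(i < D.+1) `|g i|); first exact: sumr_ge0.
move=> r x r1 xr; have := expR_polar x 0 ea el a0 al.
rewrite !cos_part0 sin_part0 -/g => h.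
have : fps_eval a x ^+ 2 <= expR (2 * fps_eval g x).
  by rewrite -h lerDl sqr_ge0.
move=> h2; apply: le_trans (ler_norm _) _.
rewrite -(@ler_pXn2r _ 2) ?nnegrE ?expR_ge0// real_normK ?num_real//.
apply: le_trans h2 _; rewrite -expRM_natl mulr_natl -mulr_natl ler_expR ler_wpM2l//.
rewrite (fps_eval_fin x gD) mulr_suml; apply: ler_sum => i _.
rewrite (le_trans (ler_norm _))// normrM ler_wpM2l// normrX.
have rD : r ^+ i <= r ^+ D by rewrite ler_weXn2l// -ltnS.
by apply: le_trans rD; rewrite lerXn2r ?qualifE//=; lra.
Qed.

(** Index [n] of [fps_dlog] carries the cumulant of order [n.+1], so the conclusion concerns the
    orders from 3 on. *)
Theorem cramer_cumulants a b D : a 0%N = 1 -> b 0%N = 1 ->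
    pos_moments a -> pos_moments b ->
    (forall n, a n.*2 <= (a * b) n.*2) -> (forall n, b n.*2 <= (a * b) n.*2) ->
    (forall n, (D <= n)%N -> fps_dlog (a * b) n = 0) ->
  forall n, (1 < n)%N -> fps_dlog a n = 0.
Proof.
move=> a0 b0 pa pb; set e := a * b => ae be eD.
have e0 : e 0%N = 1 by rewrite /e fps_mul0E a0 b0 mulr1.
have ee : entire e := entire_of_deriv (entire_finite eD) (fps_dlogP e0).
(* The logarithmic derivative of [1 / e] is minus that of [e], again a polynomial. *)
have ei : entire (fps_inv e).
  have i0 := fps_inv0 e0; apply: entire_of_deriv (fps_dlogP i0).
  by rewrite fps_dlogV//; apply/entireN/(entire_finite eD).
have ea := pos_moments_entire pa ae ee; have eb := pos_moments_entire pb be ee.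
set l := fps_dlog a; have al : fps_deriv a = l * a by exact: fps_dlogP.
have el : entire l.
  rewrite (_ : l = fps_deriv a * b * fps_inv e).
    by apply: entireM ei; apply: entireM eb; exact: entire_deriv.
  apply/esym/fps_dlog_uniq => //.
  rewrite mulrAC -(mulrA (fps_deriv a)) [b * a]mulrC -/e -mulrA.
  by rewrite fps_mulV// mulr1.
pose g := fps_int l; have eg : entire g := entire_int el.
(* Logarithm of [|a(z)| <= a(Re z)]. *)
have gle r t : fps_eval (cos_part t g) r <= fps_eval g (r * cos t).
  have := polar_norm_le r t ea pa; rewrite (expR_polar r t ea el a0 al) => h'.
  have := expR_polar (r * cos t) 0 ea el a0 al.
  rewrite !cos_part0 sin_part0 -/g => h.
  suff : expR (2 * fps_eval (cos_part t g) r) <= expR (2 * fps_eval g (r * cos t)).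
    by rewrite ler_expR ler_pM2l.
  by rewrite -h; apply: le_trans h' _; rewrite lerDl sqr_ge0.
have [K K0 eK] := fps_eval_le_exp e0 (fps_dlogP e0) eD.
have gK r x : 1 <= r -> `|x| <= r -> fps_eval g x <= (1 + K) * r ^+ D.
  move=> r1 xr; have := expR_polar x 0 ea el a0 al.
  rewrite !cos_part0 sin_part0 -/g.
  have -> : fps_eval (0 : fps R) x = 0.
    by rewrite (@fps_eval_fin _ _ 0)// big_ord1 mul0r.
  rewrite expr0n addr0 => h.
  (* Only the even coefficients of [a] are dominated by those of [e], so the odd ones are cancelled
     first: [a(x) <= a(x) + a(-x) <= e(x) + e(-x)]. *)
  have aE : fps_eval a x <= fps_eval e x + fps_eval e (- x).
    have ax := fps_eval_ge0 (- x) ea pa.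
    suff : 0 <= fps_eval (e - a) x + fps_eval (e - a) (- x).
      rewrite !fps_evalD ?fps_evalN//; [lra|exact: entireN|exact: entireN].
    have ec : entire (e - a) by apply: entireD => //; exact: entireN.
    have cv : (\sum_(i < n) (e - a) i * x ^+ i
        + \sum_(i < n) (e - a) i * (- x) ^+ i) @[n --> \oo]
        --> fps_eval (e - a) x + fps_eval (e - a) (- x).
      by apply: cvgD; exact: fps_eval_cvg.
    rewrite -(cvg_lim (@Rhausdorff R) cv); apply: limr_ge.
      by apply/cvg_ex; exists (fps_eval (e - a) x + fps_eval (e - a) (- x)).
    near=> n; rewrite /= -big_split; apply: sumr_ge0 => i _ /=.
    rewrite -mulrDr exprNn -signr_odd; have [oi|oi] := boolP (odd i).
      by rewrite expr1 mulN1r subrr mulr0.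
    have xi : 0 <= x ^+ i by rewrite exprn_even_ge0.
    rewrite expr0 mul1r; apply: mulr_ge0; last exact: addr_ge0.
    rewrite fps_addE fps_oppE subr_ge0.
    by rewrite -(odd_double_half i) (negbTE oi) add0n.
  have e1 := eK r x r1 xr; have e2 := eK r (- x) r1 (_ : `|- x| <= r).
  rewrite normrN in e2; have {e2} e2 := e2 xr.
  (* From [2 <= exp 1], the two summands of [aE] cost only 1 in the exponent. *)
  have a2 : fps_eval a x <= expR (1 + K * r ^+ D).
    rewrite expRD; have := expR_ge1Dx (1 : R); have := expR_gt0 (K * r ^+ D).
    move=> p0 q1; apply: le_trans (_ : 2 * expR (K * r ^+ D) <= _).
      by rewrite mulr_natl mulr2n (le_trans aE)// lerD.
    by rewrite ler_wpM2r// ltW.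
  have a3 : fps_eval a x ^+ 2 <= expR (1 + K * r ^+ D) ^+ 2.
    by rewrite lerXn2r ?qualifE/= ?expR_ge0 ?fps_eval_ge0.
  move: a3; rewrite h -expRM_natl mulr_natl -mulr_natl ler_expR ler_pM2l//.
  move/le_trans; apply; rewrite mulrDl mul1r lerD2r.
  by rewrite exprn_ege1.
have g0 : g 0%N = 0 by [].
have gD := real_part_degree eg g0 (_ : forall r t, 1 <= r ->
  fps_eval (cos_part t g) r <= (1 + K) * r ^+ D).
have {}gD n : (D < n)%N -> g n = 0.
  apply: gD => r t r1; apply: le_trans (gle r t) _; apply: gK => //.
  have r0 : 0 <= r by lra.
  by rewrite normrM ger0_norm// ler_piMr// ler_norml cos_geN1 cos_le1.
have g2 := real_part_le_quadratic eg gle gD.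
by move=> n n1; rewrite -(fps_intK l) fps_derivE -/g g2 ?mulr0.
Unshelve. all: by end_near. Qed.

End Cramer.

(** * Moments and independence *)

Section Moments.
Local Open Scope classical_set_scope.
Local Open Scope ring_scope.
Context {d : measure_display} {T : measurableType d} {R : realType}.
Variable P : probability T R.
Implicit Types X Y : T -> R.

Definition integrable_rv X : Prop := P.-integrable setT (EFin \o X).

Definition mean X : R := fine 'E_P[X].

Lemma mean_cst c : mean (cst c) = c.
Proof. by rewrite /mean expectation_cst. Qed.

Lemma meanE X : integrable_rv X -> ('E_P[X] = (mean X)%:E)%E.
Proof.
move=> iX; rewrite /mean fineK// expectation_fin_num//.
exact/Lfun1_integrable.
Qed.

Lemma integrable_rvD X Y : integrable_rv X -> integrable_rv Y ->
  integrable_rv (fun w => X w + Y w).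
Proof. by move=> iX iY; apply: integrableD iX iY => //. Qed.

Lemma integrable_rvZ c X : integrable_rv X -> integrable_rv (fun w => c * X w).
Proof. by move=> iX; apply: (integrableZl _ c iX). Qed.

Lemma integrable_rv_sum (I : Type) (s : seq I) (F : I -> T -> R) :
  (forall i, integrable_rv (F i)) ->
  integrable_rv (fun w => \sum_(i <- s) F i w).
Proof.
move=> iF; rewrite /integrable_rv.
rewrite (_ : _ \o _ = fun w => (\sum_(i <- s) (F i w)%:E)%E).
  by apply: integrable_sum => // i _; exact: iF.
by apply/funext => w; rewrite /= sumEFin.
Qed.

Lemma meanD X Y : integrable_rv X -> integrable_rv Y ->
  mean (fun w => X w + Y w) = mean X + mean Y.
Proof.
move=> iX iY; rewrite {1}/mean expectationD; [|exact/Lfun1_integrable..].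
by rewrite !meanE.
Qed.

Lemma meanZ c X : integrable_rv X -> mean (fun w => c * X w) = c * mean X.
Proof.
move=> iX; rewrite {1}/mean (_ : (fun w => _) = c \o* X); last first.
  by apply/funext => w /=; rewrite mulrC.
by rewrite expectationZl ?meanE//; exact/Lfun1_integrable.
Qed.

Lemma mean_sum (I : Type) (s : seq I) (F : I -> T -> R) :
  (forall i, integrable_rv (F i)) ->
  mean (fun w => \sum_(i <- s) F i w) = \sum_(i <- s) mean (F i).
Proof.
move=> iF; elim: s => [|i s IHs].
  rewrite big_nil (_ : (fun w => _) = cst 0) ?mean_cst//.
  by apply/funext => w; rewrite big_nil.
rewrite big_cons -IHs -meanD//; last exact: integrable_rv_sum.
by congr mean; apply/funext => w; rewrite big_cons.
Qed.

Lemma mean_ge0 X : (forall w, 0 <= X w) -> 0 <= mean X.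
Proof. by move=> X0; rewrite fine_ge0// expectation_ge0. Qed.

Definition indep_pair X Y : Prop := forall A B : set R,
  measurable A -> measurable B ->
  P (X @^-1` A `&` Y @^-1` B) = (P (X @^-1` A) * P (Y @^-1` B))%E.

(** Independence makes the joint law agree with the product of the laws on rectangles, hence
    everywhere; Fubini's theorem then splits the integral. *)
Lemma meanM_indep X Y : integrable_rv X -> integrable_rv Y ->
    integrable_rv (fun w => X w * Y w) -> indep_pair X Y ->
  mean (fun w => X w * Y w) = mean X * mean Y.
Proof.
move=> iX iY iXY XY.
have mX : measurable_fun setT X by apply/measurable_EFinP; case/integrableP: iX.
have mY : measurable_fun setT Y by apply/measurable_EFinP; case/integrableP: iY.
have mZ : measurable_fun setT (fun w => (X w, Y w)) by exact: measurable_fun_pair.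
pose X' : {RV P >-> R} := MeasurableFun.Pack
  (MeasurableFun.Class (isMeasurableFun.Build _ _ _ _ _ mX)).
pose Y' : {RV P >-> R} := MeasurableFun.Pack
  (MeasurableFun.Class (isMeasurableFun.Build _ _ _ _ _ mY)).
pose Z' : {RV P >-> (R * R)%type} := MeasurableFun.Pack
  (MeasurableFun.Class (isMeasurableFun.Build _ _ _ _ _ mZ)).
pose f (z : R * R) : \bar R := (z.1 * z.2)%:E.
have mf : measurable_fun setT f.
  by apply/measurable_EFinP; apply: measurable_funM.
have prodE A : measurable A ->
    (distribution P X' \x distribution P Y')%E A = distribution P Z' A.
  by move=> mA; apply: product_measure_unique.
have ifZ : (distribution P X' \x distribution P Y')%E.-integrable setT f.
  have : (distribution P Z').-integrable setT f.
    by apply: (@integrable_pushforward _ _ _ _ _ _ mZ P setT f mf) => //.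
  case/integrableP => _ h; apply/integrableP; split => //.
  rewrite (eq_measure_integral (distribution P Z'))// => A mA _.
  exact: prodE.
have EX : (\int[distribution P X']_x x%:E = (mean X)%:E)%E.
  rewrite (integral_distribution (f := EFin))//.
  by rewrite -meanE// expectation.unlock.
have EY : (\int[distribution P Y']_x x%:E = (mean Y)%:E)%E.
  rewrite (integral_distribution (f := EFin))//.
  by rewrite -meanE// expectation.unlock.
apply: EFin_inj; rewrite -meanE// expectation.unlock.
transitivity (\int[distribution P Z']_z f z)%E.
  by rewrite integral_distribution.
rewrite -(eq_measure_integral _ (fun A mA _ => prodE A mA)).
rewrite -(integral12_prod_meas1 ifZ) /fubini_F.
transitivity (\int[distribution P X']_x (x%:E * (mean Y)%:E))%E.
  apply: eq_integral => x _; rewrite -EY -integralZl//.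
  by apply: (@integrable_pushforward _ _ _ _ _ _ mY P setT EFin) => //.
rewrite integralZr//; first by rewrite EX EFinM.
by apply: (@integrable_pushforward _ _ _ _ _ _ mX P setT EFin) => //.
Qed.

End Moments.

(** * Exponential generating series of moments *)

Section MomentSeries.
Local Open Scope classical_set_scope.
Local Open Scope ring_scope.
Context {d : measure_display} {T : measurableType d} {R : realType}.
Variable P : probability T R.
Implicit Types X Y : T -> R.

Notation mean := (mean P).
Notation integrable_rv := (integrable_rv P).
Notation indep_pair := (indep_pair P).
Notation finite_moments := (finite_moments P).

Lemma finite_moments_measurable X : finite_moments X -> measurable_fun setT X.
Proof.
by move=> /(_ 1%N) /integrableP[/measurable_EFinP h _]; exact: h.
Qed.

(** Domination through [|u v| <= u^2 + v^2]. *)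
Lemma integrable_moments X Y m n : finite_moments X -> finite_moments Y ->
  integrable_rv (fun w => X w ^+ m * Y w ^+ n).
Proof.
move=> fX fY; have mX := finite_moments_measurable fX.
have mY := finite_moments_measurable fY.
have iS : integrable_rv (fun w => X w ^+ (m + m) + Y w ^+ (n + n)).
  by apply: integrable_rvD; [exact: fX|exact: fY].
apply: (@le_integrable _ _ _ _ _ _ _ _ _ _ iS) => //.
  by apply/measurable_EFinP/measurable_funM; exact: measurable_funX.
move=> w _ /=; rewrite lee_fin !exprD -!expr2.
rewrite [leRHS]ger0_norm ?addr_ge0 ?sqr_ge0// normrM.
rewrite -(real_normK (num_real (X w ^+ m))) -(real_normK (num_real (Y w ^+ n))).
set u := `|X w ^+ m|; set v := `|Y w ^+ n|.
have := sqr_ge0 (u - v).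
have := mulr_ge0 (normr_ge0 (X w ^+ m)) (normr_ge0 (Y w ^+ n)).
by rewrite -/u -/v; nra.
Qed.

Lemma finite_momentsD X Y : finite_moments X -> finite_moments Y ->
  finite_moments (fun w => X w + Y w).
Proof.
move=> fX fY n; rewrite -/(integrable_rv _).
rewrite (_ : (fun w => _) = fun w =>
    \sum_(i < n.+1) 'C(n, i)%:R * (X w ^+ (n - i) * Y w ^+ i)).
  apply: integrable_rv_sum => i; apply: integrable_rvZ.
  exact: integrable_moments.
by apply/funext => w; rewrite exprDn; apply: eq_bigr => i _; rewrite mulr_natl.
Qed.

Lemma finite_momentsZ c X : finite_moments X -> finite_moments (fun w => c * X w).
Proof.
move=> fX n; rewrite -/(integrable_rv _).
rewrite (_ : (fun w => _) = fun w => c ^+ n * X w ^+ n).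
  by apply: integrable_rvZ; exact: fX.
by apply/funext => w; rewrite exprMn.
Qed.

Lemma finite_moments_sum (I : Type) (s : seq I) (Q : pred I) (F : I -> T -> R) :
  (forall i, finite_moments (F i)) ->
  finite_moments (fun w => \sum_(i <- s | Q i) F i w).
Proof.
move=> fF; elim: s => [|i s IHs].
  move=> n; rewrite (_ : _ \o _ = EFin \o cst (0 ^+ n)).
    by apply: finite_measure_integrable_cst.
  by apply/funext => w; rewrite /= big_nil.
rewrite (_ : (fun w => _) = fun w =>
    (if Q i then F i w else 0) + \sum_(j <- s | Q j) F j w).
  apply: finite_momentsD IHs; case: (Q i); first exact: fF.
  move=> n; rewrite (_ : _ \o _ = EFin \o cst (0 ^+ n))//.
  by apply: finite_measure_integrable_cst.
by apply/funext => w; rewrite big_cons; case: ifP => //; rewrite add0r.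
Qed.

Definition moment X n : R := mean (fun w => X w ^+ n).

(** The moment generating function as a formal series: finite moments alone do not ensure a positive
    radius of convergence. *)
Definition moment_egf X : fps R := fun n => moment X n / n`!%:R.

Lemma moment0 X : moment X 0%N = 1.
Proof.
by rewrite /moment (_ : (fun w => _) = cst 1) ?mean_cst.
Qed.

Lemma moment_egf0 X : moment_egf X 0%N = 1.
Proof. by rewrite /moment_egf moment0 divr1. Qed.

Lemma moment1 X : moment X 1%N = mean X.
Proof. by []. Qed.

Lemma fact_moment_egf X n : n`!%:R * moment_egf X n = moment X n.
Proof.
by rewrite /moment_egf mulrCA mulfV ?mulr1// pnatr_eq0 -lt0n fact_gt0.
Qed.

Lemma moment_egfZ c X : finite_moments X ->
  moment_egf (fun w => c * X w) = fps_scale c (moment_egf X).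
Proof.
move=> fX; apply/funext => n; rewrite /moment_egf /fps_scale /moment.
rewrite (_ : (fun w => _) = fun w => c ^+ n * X w ^+ n).
  by rewrite meanZ ?mulrA//; exact: fX.
by apply/funext => w; rewrite exprMn.
Qed.

Lemma indep_pairX X Y m n : measurable_fun setT X -> measurable_fun setT Y ->
  indep_pair X Y -> indep_pair (fun w => X w ^+ m) (fun w => Y w ^+ n).
Proof.
move=> mX mY XY A B mA mB.
have pow k (C : set R) : measurable C -> measurable ((fun x : R => x ^+ k) @^-1` C).
  move=> mC; rewrite -[X in measurable X]setTI.
  exact: (@measurable_funX _ _ R _ id k (@measurable_id _ _ _)).
exact: (XY ((fun x => x ^+ m) @^-1` A) ((fun x => x ^+ n) @^-1` B)
  (pow _ _ mA) (pow _ _ mB)).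
Qed.

Lemma mean_momentM X Y m n : finite_moments X -> finite_moments Y ->
  indep_pair X Y -> mean (fun w => X w ^+ m * Y w ^+ n) = moment X m * moment Y n.
Proof.
move=> fX fY XY; apply: meanM_indep; [exact: fX|exact: fY| |].
  exact: integrable_moments.
by apply: indep_pairX => //; exact: finite_moments_measurable.
Qed.

(** Independence turns the binomial expansion of the moments into a Cauchy product. *)
Lemma moment_egfD X Y : finite_moments X -> finite_moments Y ->
  indep_pair X Y ->
  moment_egf (fun w => X w + Y w) = moment_egf X * moment_egf Y.
Proof.
move=> fX fY XY; apply/funext => n.
rewrite fps_mulE /moment_egf /moment.
rewrite (_ : (fun w => _) = fun w =>
    \sum_(i < n.+1) 'C(n, i)%:R * (X w ^+ i * Y w ^+ (n - i))).
  rewrite mean_sum => [|i]; last exact/integrable_rvZ/integrable_moments.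
  rewrite mulr_suml; apply: eq_bigr => i _.
  rewrite meanZ; last exact: integrable_moments.
  rewrite mean_momentM// -!/(moment _ _).
  have ni : (i <= n)%N by rewrite -ltnS.
  rewrite -(bin_fact ni) !natrM.
  have f0 k : k`!%:R != 0 :> R by rewrite pnatr_eq0 -lt0n fact_gt0.
  by field; rewrite !f0 pnatr_eq0 -lt0n bin_gt0.
apply/funext => w; rewrite addrC exprDn; apply: eq_bigr => i _.
by rewrite mulr_natl mulrC.
Qed.

(** The quadratic form is the mean of the square of [\sum_i q i * X^i]. *)
Lemma pos_moments_egf X : finite_moments X -> pos_moments (moment_egf X).
Proof.
move=> fX N q.
have iX k (c : R) : integrable_rv (fun w => c * X w ^+ k).
  by apply: integrable_rvZ; exact: fX.
rewrite (_ : \sum_(i < N) _ = mean (fun w => (\sum_(i < N) q i * X w ^+ i) ^+ 2)).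
  by apply: mean_ge0 => w; exact: sqr_ge0.
rewrite (_ : (fun w => _) = fun w =>
    \sum_(i < N) \sum_(j < N) (q i * q j) * X w ^+ (i + j)).
  rewrite mean_sum => [|i]; last by apply: integrable_rv_sum.
  apply: eq_bigr => i _; rewrite mean_sum//; apply: eq_bigr => j _.
  by rewrite fact_moment_egf meanZ//; exact: fX.
apply/funext => w; rewrite expr2 mulr_suml; apply: eq_bigr => i _.
rewrite mulr_sumr; apply: eq_bigr => j _; rewrite exprD; ring.
Qed.

Lemma expr_double_tangent (x y : R) n :
  x ^+ n.*2 + n.*2%:R * (x ^+ n.*2.-1 * y) <= (x + y) ^+ n.*2.
Proof.
case: n => [|n]; first by rewrite !expr0 mul0r addr0.
(* The tangent inequality for powers on the half-line is applied to the squares of [x + y] and [x];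
   replacing the difference of these squares by [2 * x * y] drops a nonnegative multiple of
   [y^2]. *)
have tangent (a b : R) k : 0 <= a -> 0 <= b ->
    b ^+ k.+1 + k.+1%:R * (b ^+ k * (a - b)) <= a ^+ k.+1.
  move=> a0 b0; elim: k => [|k IHk].
    by rewrite !expr1 expr0 !mul1r [leLHS]addrC subrK.
  rewrite [a ^+ k.+2]exprS; apply: le_trans (ler_wpM2l a0 IHk).
  have : 0 <= k.+1%:R * (b ^+ k * (a - b) ^+ 2).
    by rewrite mulr_ge0// mulr_ge0 ?sqr_ge0 ?exprn_ge0.
  rewrite -subr_ge0 => h; rewrite -subr_ge0; move: h; congr (_ <= _).
  by rewrite -(natr1 k.+1) !exprS; ring.
have := tangent ((x + y) ^+ 2) (x ^+ 2) n (sqr_ge0 _) (sqr_ge0 _).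
rewrite -!exprM mul2n; apply: le_trans; rewrite lerD2l.
rewrite mul2n doubleS /= -doubleS -mul2n natrM.
have -> : (x + y) ^+ 2 - x ^+ 2 = 2 * x * y + y ^+ 2 by ring.
rewrite mulrDr mulrDr -subr_ge0.
have : 0 <= n.+1%:R * (x ^+ n.*2 * y ^+ 2).
  by rewrite mulr_ge0// mulr_ge0 ?sqr_ge0// exprn_even_ge0// odd_double.
by congr (_ <= _); rewrite (exprS x n.*2); ring.
Qed.

(** Take the mean of [expr_double_tangent]: the linear term vanishes because [Y] is centred and
    independent of [X]. *)
Lemma moment_double_le X Y n : finite_moments X -> finite_moments Y ->
    indep_pair X Y -> mean Y = 0 ->
  moment X n.*2 <= moment (fun w => X w + Y w) n.*2.
Proof.
move=> fX fY XY Y0; have fXY := finite_momentsD fX fY.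
pose Z w := n.*2%:R * (X w ^+ n.*2.-1 * Y w ^+ 1).
have iZ : integrable_rv Z by apply/integrable_rvZ/integrable_moments.
have mZ : mean Z = 0.
  rewrite meanZ; last exact: integrable_moments.
  by rewrite mean_momentM// moment1 Y0 !mulr0.
have iD : integrable_rv (fun w => X w ^+ n.*2 + Z w).
  by apply: integrable_rvD => //; exact: fX.
have -> : moment X n.*2 = mean (fun w => X w ^+ n.*2 + Z w).
  by rewrite meanD ?mZ ?addr0//; exact: fX.
rewrite /moment -subr_ge0 -[- _]mulN1r -meanZ// -meanD//; last 2 first.
- exact: fXY.
- exact: integrable_rvZ.
apply: mean_ge0 => w; rewrite mulN1r subr_ge0 /Z expr1.
exact: expr_double_tangent.
Qed.

Lemma cramer_rv X Y D : finite_moments X -> finite_moments Y ->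
    indep_pair X Y -> mean X = 0 -> mean Y = 0 ->
    (forall n, (D <= n)%N -> fps_dlog (moment_egf (fun w => X w + Y w)) n = 0) ->
  forall n, (1 < n)%N -> fps_dlog (moment_egf X) n = 0.
Proof.
move=> fX fY XY X0 Y0; rewrite moment_egfD// => h.
have YX : indep_pair Y X.
  by move=> A B mA mB; rewrite setIC muleC; exact: XY.
apply: cramer_cumulants h; rewrite ?moment_egf0//; try exact: pos_moments_egf.
- move=> n; rewrite -moment_egfD// /moment_egf ler_wpM2r ?invr_ge0//.
  exact: moment_double_le.
- move=> n; rewrite mulrC -moment_egfD// /moment_egf ler_wpM2r ?invr_ge0//.
  exact: moment_double_le.
Qed.

(** For a centred variable, [3! * fps_dlog _ 3] is [m_4 - 3 m_2^2], as seen by comparing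
    coefficients in [a' = l a] up to order 3. *)
Lemma moment4_of_dlog X : mean X = 0 -> fps_dlog (moment_egf X) 3 = 0 ->
  moment X 4 = 3 * moment X 2 ^+ 2.
Proof.
move=> X0; set a := moment_egf X; set l := fps_dlog a.
have a0 : a 0%N = 1 := moment_egf0 X.
have a1 : a 1%N = 0 by rewrite /a /moment_egf moment1 X0 mul0r.
have := fps_dlogP a0; rewrite -/l => al l3.
have coef n := congr1 (fun f : fps R => f n) al.
have := coef 0%N; have := coef 1%N; have := coef 2; have := coef 3.
rewrite /= !fps_derivE !fps_mulE !big_ord_recl !big_ord0 /= /bump /=.
rewrite !subn0 ?subnn ?subSS ?subn0 a0 a1 l3 => d3 d2 d1 d0.
have l0 : l 0%N = 0 by move: d0; lra.
have l1 : l 1%N = 2 * a 2 by move: d1; rewrite l0; lra.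
have a4 : 4 * a 4 = 2 * a 2 ^+ 2.
  by move: d3; rewrite /addn /= l0 l1 expr2; lra.
rewrite -!fact_moment_egf -/a.
have -> : 4`!%:R = 6 * 4 :> R by rewrite -natrM.
have -> : 2`!%:R = 2 :> R by [].
rewrite -mulrA a4; move: (a 2%N) => x; ring.
Qed.

End MomentSeries.

(** * Independence of a component from a combination of others *)

Section MutualIndependence.
Local Open Scope classical_set_scope.
Local Open Scope ring_scope.
Context {d : measure_display} {T : measurableType d} {R : realType}.
Variable P : probability T R.

Lemma indep_pairZr c (X Y : T -> R) : indep_pair P X Y ->
  indep_pair P X (fun w => c * Y w).
Proof.
move=> XY A B mA mB; apply: (XY A ((fun x => c * x) @^-1` B)) => //.
rewrite -[X in measurable X]setTI.
exact: (@measurable_funM _ _ R _ (cst c) id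
  (@measurable_cst _ _ _ _ _ _) (@measurable_id _ _ _)).
Qed.

(** Two measures, [P] restricted to the event of [X c] and a multiple of [P], agree on the finite
    intersections [G], a pi-system. Hence they agree on the sigma-algebra it generates, for which
    the sum is measurable. *)
Lemma indep_sum_component (I : finType) (X : I -> T -> R) (a : I -> R)
    (J : {set I}) (c : I) : (forall i, measurable_fun setT (X i)) ->
  mutually_independent P X -> c \notin J ->
  indep_pair P (fun w => \sum_(k in J) a k * X k w) (X c).
Proof.
move=> mX indX cJ A B mA mB.
have mpre i (C : set R) : measurable C -> measurable (X i @^-1` C).
  by move=> mC; rewrite -[X in measurable X]setTI; exact: mX.
pose G : set_system T := [set E | exists C : I -> set R,
  (forall i, measurable (C i)) /\ E = \bigcap_(i in [set` J]) (X i @^-1` C i)].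
have capm (C : I -> set R) : (forall i, measurable (C i)) ->
    measurable (\bigcap_(i in [set` J]) (X i @^-1` C i)).
  move=> mC; apply: fin_bigcap_measurable => // i _; exact: mpre.
have Gm : G `<=` measurable by move=> _ [C [mC ->]]; exact: capm.
have GT : G setT.
  exists (fun=> setT); split => //.
  by apply/esym; rewrite -subTset => w _ i _.
have GI : setI_closed G.
  move=> _ _ [C [mC ->]] [D [mD ->]]; exists (fun i => C i `&` D i); split.
    by move=> i; exact: measurableI.
  by rewrite -bigcapI; apply: eq_bigcapr => i _; rewrite preimage_setI.
have mW : measurable_fun [set: g_sigma_algebraType G]
    (fun w => \sum_(k in J) a k * X k w).
  rewrite (_ : (fun w => _) = fun w => \sum_k (if k \in J then a k * X k w else 0)).
    apply: measurable_sum => k.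
    have [kJ|_] := boolP (k \in J); last exact: measurable_cst.
    apply: measurable_funM; first exact: measurable_cst.
    move=> _ C mC; rewrite setTI; apply: sub_sigma_algebra.
    exists (fun i => if i == k then C else setT); split.
      by move=> i; case: ifP.
    rewrite eqEsubset; split => w /=.
      by move=> Cw i _; case: eqP => // ->.
    by move=> /(_ k kJ) /=; rewrite eqxx.
  by apply/funext => w; rewrite [LHS]big_mkcond.
have GW : <<s G >> ((fun w => \sum_(k in J) a k * X k w) @^-1` A).
  by have := mW measurableT A mA; rewrite setTI.
have mB' := mpre c B mB.
pose r : {nonneg R} := NngNum (fine_ge0 (measure_ge0 P (X c @^-1` B))).
have rE : (r%:num)%:E = P (X c @^-1` B) by rewrite /= fineK// fin_num_measure.
have uniq : forall E, <<s G >> E -> mrestr P mB' E = mscale r P E.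
  apply: (@g_sigma_algebra_measure_unique _ _ _ G Gm (fun=> setT)) => //.
  - by rewrite bigcup_const.
  - move=> _ [C [mC ->]].
    rewrite -[LHS]/(P (_ `&` _)) -[RHS]/((r%:num)%:E * P _)%E rE.
    (* Mutual independence is used twice with the same family: over [J] and over [J] enlarged by
       [c], whose event is that of [B]. *)
    pose C' i := if i == c then B else C i.
    have mC' i : measurable (C' i) by rewrite /C'; case: ifP.
    have C'c : C' c = B by rewrite /C' eqxx.
    have := indX (c |: J) C' mC'; rewrite big_setU1//= C'c => h.
    have hJ : \bigcap_(i in [set` J]) (X i @^-1` C' i)
        = \bigcap_(i in [set` J]) (X i @^-1` C i).
      apply: eq_bigcapr => i /= iJ; rewrite /C'; case: eqP iJ => // ->.
      by rewrite (negbTE cJ).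
    rewrite -hJ (indX J C' mC') -h; congr (P _).
    rewrite eqEsubset; split => w /=.
      move=> [Jw Bw] i /=; rewrite in_setU1 => /orP[/eqP ->|]; last exact: Jw.
      by rewrite C'c.
    move=> Jw; split.
      by move=> i iJ; apply: Jw; rewrite /= in_setU1 iJ orbT.
    by have := Jw c; rewrite C'c /= in_setU1 eqxx; exact.
  - move=> k; rewrite -[X in (X < _)%E]/(P (_ `&` _)).
    rewrite (le_lt_trans (probability_le1 _ _)) ?ltry//.
    exact: measurableI.
have := uniq _ GW; rewrite -[LHS]/(P (_ `&` _)) -[RHS]/((r%:num)%:E * P _)%E.
by rewrite rE muleC.
Qed.

End MutualIndependence.

(** * The Darmois-Skitovich theorem *)

Section DarmoisSkitovich.
Context {d : measure_display} {T : measurableType d} {R : realType}.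
Variable P : probability T R.

Lemma poly_eq0_roots (p : {poly R}) : (forall t, p.[t] = 0) -> p = 0.
Proof.
move=> pt; apply/eqP/negPn/negP => p0.
have := @max_poly_roots _ p [seq i%:R | i <- iota 0 (size p)] p0.
rewrite size_map size_iota ltnn => h; suff : false by []. apply: h.
  by apply/allP => x _; apply/rootP.
by rewrite map_inj_uniq ?iota_uniq// => i j /eqP; rewrite eqr_nat => /eqP.
Qed.

Lemma coef_affine_exp (a b : R) m j : (j <= m)%N ->
  ((a%:P + b *: 'X) ^+ m)`_j = 'C(m, j)%:R * (a ^+ (m - j) * b ^+ j).
Proof.
move=> jm; rewrite exprDn coef_sum; have jm1 : (j < m.+1)%N by [].
rewrite (bigD1 (Ordinal jm1))//= big1 ?addr0 => [|i ij].
  rewrite coefMn exprZn -scalerAr coefZ -polyC_exp coefCM coefXn eqxx mulr1.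
  by rewrite mulr_natl [b ^+ j * _]mulrC.
rewrite coefMn exprZn -scalerAr coefZ -polyC_exp coefCM coefXn.
case: eqP => [e|_]; last by rewrite !mulr0 mul0rn.
by move/eqP: ij => []; exact/val_inj/esym.
Qed.

Variables (I : finType) (S : I -> T -> R).
Hypothesis finS : forall k, finite_moments P (S k).
Hypothesis meanS : forall k, mean P (S k) = 0.
Hypothesis indepS : mutually_independent P S.

Let mS k : measurable_fun setT (S k) := finite_moments_measurable (finS k).

Let l k := fps_dlog (moment_egf P (S k)).

Let comb (J : {set I}) (a : I -> R) w := \sum_(k in J) a k * S k w.

Let comb_finite J a : finite_moments P (comb J a).
Proof. by apply: finite_moments_sum => k; exact: finite_momentsZ. Qed.

Let comb_mean J a : mean P (comb J a) = 0.
Proof.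
rewrite (_ : comb J a = fun w => \sum_(k <- enum J) a k * S k w).
  rewrite mean_sum => [|k]; last exact: integrable_rvZ (finS k 1).
  by rewrite big1// => k _; rewrite meanZ ?meanS ?mulr0//; exact: (finS k 1).
by apply/funext => w; rewrite /comb big_enum.
Qed.

Let comb_setD1 (J : {set I}) a c : c \in J ->
  comb J a = fun w => comb (J :\ c) a w + a c * S c w.
Proof.
by move=> cJ; apply/funext => w; rewrite /comb (big_setD1 c)//= addrC.
Qed.

Let comb_indep (J : {set I}) a c : c \in J ->
  indep_pair P (comb (J :\ c) a) (fun w => a c * S c w).
Proof.
by move=> cJ; apply/indep_pairZr/indep_sum_component => //; rewrite !inE eqxx.
Qed.

(** Cumulants are additive over independent summands and homogeneous; components are removed from
    [J] one at a time. *)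
Lemma fps_dlog_comb J a n :
  fps_dlog (moment_egf P (comb J a)) n = \sum_(k in J) a k ^+ n.+1 * l k n.
Proof.
elim: {J}#|J| {-2}J (erefl #|J|) => [|m IHm] J cardJ.
  move/eqP: cardJ; rewrite cards_eq0 => /eqP ->; rewrite big_set0.
  have -> : moment_egf P (comb finset.set0 a) = 1.
    apply/funext => k; rewrite /moment_egf /moment.
    rewrite (_ : (fun w => _) = cst (0 ^+ k)); last first.
      by apply/funext => w; rewrite /comb big_set0.
    by rewrite mean_cst expr0n fps_oneE; case: k => [|k]; rewrite ?mul0r// divr1.
  by rewrite fps_dlog1.
have [c cJ] : exists c, c \in J by apply/set0Pn; rewrite -cards_eq0 cardJ.
rewrite (comb_setD1 a cJ) moment_egfD//; last 2 first.
- exact: finite_momentsZ.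
- exact: comb_indep.
rewrite fps_dlogM ?moment_egf0// fps_addE IHm; last first.
  by move: cardJ; rewrite (cardsD1 c) cJ => -[].
rewrite moment_egfZ// fps_dlog_scale ?moment_egf0// (big_setD1 c cJ)/= addrC.
by [].
Qed.

(** The cumulant of [U + t V] is a polynomial in [t], and by independence it equals [u + t^(n+1) v];
    the intermediate coefficients therefore vanish. *)
Lemma indep_comb_dlog (a b : I -> R) n j :
    indep_pair P (comb [set: I] a) (comb [set: I] b) -> (0 < j <= n)%N ->
  \sum_k l k n * (a k ^+ (n.+1 - j) * b k ^+ j) = 0.
Proof.
move=> ab /andP[j0 jn].
pose u := fps_dlog (moment_egf P (comb [set: I] a)) n.
pose v := fps_dlog (moment_egf P (comb [set: I] b)) n.
pose p : {poly R} := \sum_k l k n *: ((a k)%:P + b k *: 'X) ^+ n.+1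
  - u%:P - v *: 'X^(n.+1).
have p0 : p = 0.
  apply: poly_eq0_roots => t.
  rewrite /p !hornerE horner_sum.
  have -> : \sum_k (l k n *: ((a k)%:P + b k *: 'X) ^+ n.+1).[t]
      = fps_dlog (moment_egf P (comb [set: I] (fun k => a k + t * b k))) n.
    rewrite fps_dlog_comb; apply: eq_big => [k|k _]; first by rewrite inE.
    by rewrite hornerZ horner_exp !hornerE mulrC (mulrC t).
  have -> : comb [set: I] (fun k => a k + t * b k)
      = fun w => comb [set: I] a w + t * comb [set: I] b w.
    apply/funext => w; rewrite /comb mulr_sumr -big_split; apply: eq_bigr => k _.
    by rewrite mulrDl mulrA.
  rewrite moment_egfD//; [|exact: finite_momentsZ|exact: indep_pairZr].
  rewrite fps_dlogM ?moment_egf0// fps_addE moment_egfZ//.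
  by rewrite fps_dlog_scale ?moment_egf0// -/u -/v; ring.
have := congr1 (fun q : {poly R} => q`_j) p0.
rewrite /p !coefB coef_sum coefC coefZ coefXn coef0.
rewrite (gtn_eqF j0) (ltn_eqF (_ : j < n.+1)%N)// mulr0 !subr0.
under eq_bigr do rewrite coefZ coef_affine_exp ?(leqW jn)// mulrCA.
rewrite -mulr_sumr => /eqP; rewrite mulf_eq0 pnatr_eq0 -leqn0 leqNgt bin_gt0.
by rewrite (leqW jn)/= => /eqP.
Qed.

(** The relations of [indep_comb_dlog] are combined with the coefficients of a polynomial [h] that
    vanishes at 0 and at all ratios other than that of [c]. The root 0 removes the term [j = 0], and
    [#|I| < n] keeps the degree of [h] at most [n]. *)
Lemma indep_comb_ratio (a b : I -> R) c n :
    indep_pair P (comb [set: I] a) (comb [set: I] b) ->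
    a c != 0 -> b c != 0 -> (#|I| < n)%N ->
  \sum_(k in [set k | (a k != 0) && (b k / a k == b c / a c)])
    a k ^+ n.+1 * l k n = 0.
Proof.
move=> ab ac bc In; pose rho k := b k / a k.
pose others := [seq rho k | k <- enum I & rho k != rho c].
pose h : {poly R} := 'X * \prod_(x <- others) ('X - x%:P).
have rc : rho c != 0 by rewrite mulf_neq0 ?invr_eq0.
have hc : h.[rho c] != 0.
  rewrite /h hornerM hornerX mulf_neq0// -/(root _ _) root_prod_XsubC.
  by apply/mapP => -[k]; rewrite mem_filter => /andP[/eqP kc _] ck; apply: kc.
have h0 : h`_0 = 0 by rewrite -horner_coef0 /h hornerM hornerX mul0r.
have sh : (size h <= n.+1)%N.
  rewrite /h mulrC size_mulX ?monic_neq0 ?monic_prod_XsubC// size_prod_XsubC.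
  rewrite ltnS (leq_ltn_trans _ In)// size_map size_filter.
  by rewrite (leq_trans (count_size _ _))// -cardE.
have hk k : k \notin [set k | (a k != 0) && (rho k == rho c)] -> a k != 0 ->
    h.[rho k] = 0.
  rewrite inE => kn ak; rewrite ak /= in kn; rewrite /h hornerM.
  have /rootP -> : root (\prod_(x <- others) ('X - x%:P)) (rho k).
    by rewrite root_prod_XsubC; apply: map_f; rewrite mem_filter kn mem_enum.
  by rewrite mulr0.
have : \sum_(j < n.+1) h`_j * (\sum_k l k n * (a k ^+ (n.+1 - j) * b k ^+ j)) = 0.
  rewrite big1// => j _; have [j0|j0] := posnP j; first by rewrite j0 h0 mul0r.
  by rewrite indep_comb_dlog ?mulr0// j0 -ltnS ltn_ord.
have -> : \sum_(j < n.+1) h`_j * (\sum_k l k n * (a k ^+ (n.+1 - j) * b k ^+ j))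
    = \sum_k l k n * (a k ^+ n.+1 * h.[rho k]).
  under eq_bigr do rewrite mulr_sumr.
  rewrite exchange_big; apply: eq_bigr => k _ /=.
  (* Here [rho k] is a division by 0, but both sides vanish: the exponent [n.+1 - j] is positive. *)
  have [ak|ak] := eqVneq (a k) 0.
    rewrite ak expr0n /= !mul0r mulr0 big1// => j _.
    by rewrite expr0n subn_eq0 leqNgt ltn_ord /= mul0r !mulr0.
  rewrite (horner_coef_wide _ sh) !mulr_sumr; apply: eq_bigr => j _.
  have jn : (j <= n.+1)%N by rewrite ltnW.
  have -> : a k ^+ n.+1 = a k ^+ (n.+1 - j) * a k ^+ j by rewrite -exprD subnK.
  rewrite /rho expr_div_n.
  by field; rewrite expf_neq0.
rewrite (bigID (mem [set k | (a k != 0) && (rho k == rho c)]))/=.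
rewrite [X in _ + X]big1 ?addr0 => [|k kn]; last first.
  have [->|ak] := eqVneq (a k) 0; first by rewrite expr0n /= mul0r mulr0.
  by rewrite hk// !mulr0.
move=> hs; apply/eqP; rewrite -(mulIr_eq0 _ (mulIf hc)) mulr_suml -[X in _ == X]hs.
apply/eqP/eq_bigr => k; rewrite inE => /andP[_ /eqP kc].
by have -> : rho k = rho c := kc; ring.
Qed.

(** The conclusion is the fourth-moment identity of a centred Gaussian variable. *)
Theorem darmois_skitovich_moment4 (a b : I -> R) c :
    indep_pair P (fun w => \sum_k a k * S k w) (fun w => \sum_k b k * S k w) ->
    a c != 0 -> b c != 0 ->
  moment P (S c) 4 = 3 * moment P (S c) 2 ^+ 2.
Proof.
have combT e : (fun w => \sum_k e k * S k w) = comb [set: I] e.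
  by apply/funext => w; apply: eq_bigl => k; rewrite inE.
rewrite !combT => ab ac bc.
pose G := [set k | (a k != 0) && (b k / a k == b c / a c)].
have cG : c \in G by rewrite inE ac eqxx.
apply: moment4_of_dlog => //.
have fX : finite_moments P (fun w => a c * S c w) by exact: finite_momentsZ.
have XY : indep_pair P (fun w => a c * S c w) (comb (G :\ c) a).
  by move=> A B mA mB; rewrite setIC muleC; exact: comb_indep.
have X0 : mean P (fun w => a c * S c w) = 0.
  by rewrite meanZ ?meanS ?mulr0//; exact: (finS c 1).
(* By [indep_comb_ratio], the logarithmic derivative for the partial sum over [G] vanishes from
   index [#|I|.+1] on. *)
have := @cramer_rv _ _ _ P _ _ #|I|.+1 fX (comb_finite _ _) XY X0 (comb_mean _ _).
have -> : (fun w => a c * S c w + comb (G :\ c) a w) = comb G a.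
  by rewrite (comb_setD1 a cG); apply/funext => w; rewrite addrC.
move=> /(_ _ 3%N isT) h.
have : fps_dlog (moment_egf P (fun w => a c * S c w)) 3 = 0.
  by apply: h => n In; rewrite fps_dlog_comb; exact: indep_comb_ratio.
rewrite moment_egfZ// fps_dlog_scale ?moment_egf0// => /eqP.
by rewrite mulf_eq0 expf_eq0 (negbTE ac) andbF => /eqP.
Qed.

End DarmoisSkitovich.

(** * The fourth cumulant *)

Section FourthCumulant.

Lemma partition_setC (I : finType) (D : {set I}) :
  D != finset.set0 -> ~: D != finset.set0 ->
  finset.partition [set D; ~: D] [set: I].
Proof.
move=> D0 D'0; have DD' : D \notin [set ~: D].
  rewrite inE; apply: contraNN D0 => /eqP DD'.
  by rewrite -(finset.setIid D) {2}DD' finset.setICr.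
have cov : finset.cover [set D; ~: D] = [set: I].
  by rewrite /finset.cover big_setU1//= big_set1 finset.setUCr.
apply/and3P; split; first by rewrite cov.
- by rewrite /finset.trivIset cov big_setU1//= big_set1 cardsC cardsT.
- by rewrite !inE negb_or eq_sym D0 eq_sym D'0.
Qed.

(** The splittings of four indices into two pairs are indexed by the partner [x] of [ord0]. *)
Let pair_split (x : 'I_4) : {set {set 'I_4}} :=
  [set [set ord0; x]; ~: [set ord0; x]].

Let pair_splits : {set {set {set 'I_4}}} :=
  [set pair_split x | x in [set~ ord0]].

Let card_pair (x : 'I_4) : x != ord0 -> #|[set ord0; x]| = 2.
Proof. by move=> x0; rewrite cards2 eq_sym x0. Qed.

Let card_pairC (x : 'I_4) : x != ord0 -> #|~: [set ord0; x]| = 2.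
Proof. by move=> x0; rewrite cardsCs finset.setCK card_pair// card_ord. Qed.

Let partition_pair_split (x : 'I_4) : x != ord0 ->
  finset.partition (pair_split x) [set: 'I_4].
Proof.
by move=> x0; apply: partition_setC; rewrite -card_gt0 ?card_pair ?card_pairC.
Qed.

Let pair_split_inj : {in [set~ ord0] &, injective pair_split}.
Proof.
move=> x y; rewrite !inE => x0 y0 xy.
have : [set ord0; x] \in pair_split y by rewrite -xy !inE eqxx.
rewrite !inE => /orP[/eqP e|/eqP e].
  have : x \in [set ord0; y] by rewrite -e !inE eqxx orbT.
  by rewrite !inE (negbTE x0) => /eqP.
have : ord0 \in ~: [set ord0; y] by rewrite -e !inE eqxx.
by rewrite !inE eqxx.
Qed.

(** All blocks have at least two of the four elements, so the block of [ord0] is everything or a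
    pair whose complement is the only other block. *)
Let partition4P (Q : {set {set 'I_4}}) : finset.partition Q [set: 'I_4] ->
  (forall D, D \in Q -> #|D| != 1%N) ->
  Q = [set [set: 'I_4]] \/ Q \in pair_splits.
Proof.
move=> /and3P[/eqP covQ trivQ nQ0] Q1.
have card2 D : D \in Q -> (2 <= #|D|)%N.
  move=> DQ; have := Q1 D DQ; have : #|D| != 0%N.
    by rewrite cards_eq0; apply: contraNN nQ0 => /eqP <-.
  by case: #|D| => [|[|]].
have inQ x : finset.pblock Q x \in Q by rewrite finset.pblock_mem// covQ.
have xin x : x \in finset.pblock Q x by rewrite finset.mem_pblock covQ.
have /finset.trivIsetP disj := trivQ.
pose D := finset.pblock Q ord0; have DQ : D \in Q := inQ ord0.
have only (E : {set 'I_4}) : E \in Q -> forall B, B \in Q -> E :|: D = [set: 'I_4] ->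
    B = E \/ B = D.
  move=> EQ B BQ ED; have [/eqP|BE] := boolP (B == E); first by left.
  have [/eqP|BD] := boolP (B == D); first by right.
  have h1 := disj _ _ BQ EQ BE; have h2 := disj _ _ BQ DQ BD.
  have /finset.set0Pn[y yB] : B != finset.set0 by rewrite -card_gt0 ltnW ?card2.
  have : y \in E :|: D by rewrite ED inE.
  rewrite inE => /orP[yE|yD].
    by move/pred0P: h1 => /(_ y); rewrite /= yB yE.
  by move/pred0P: h2 => /(_ y); rewrite /= yB yD.
have [DT|/eqP DT] := eqVneq D [set: 'I_4].
  left; apply/setP => B; rewrite inE; apply/idP/eqP => [BQ|->]; last by rewrite -DT.
  by have [] := only D DQ B BQ; rewrite ?finset.setUid// DT.
right; have /finset.set0Pn[y] : ~: D != finset.set0.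
  by apply/eqP => /(congr1 (@finset.setC _)); rewrite finset.setCK finset.setC0 => /DT.
rewrite inE => yD; pose E := finset.pblock Q y; have EQ : E \in Q := inQ y.
have ED : E != D by apply: contraNneq yD => <-; exact: xin.
have dED := disj _ _ EQ DQ ED.
have cED : (#|E| + #|D| <= 4)%N.
  rewrite -cardsUI; move: dED; rewrite -finset.setI_eq0 => /eqP ->.
  by rewrite cards0 addn0 (leq_trans (max_card _))// card_ord.
have D2 : #|D| = 2%N by have := card2 E EQ; have := card2 D DQ; lia.
have E2 : #|E| = 2%N by have := card2 E EQ; have := card2 D DQ; lia.
have EDT : E :|: D = [set: 'I_4].
  apply/eqP; rewrite eqEcard finset.subsetT cardsT card_ord /=.
  rewrite cardsU (eqP (_ : E :&: D == finset.set0)) ?finset.setI_eq0//.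
  by rewrite cards0 subn0 D2 E2.
have EC : E = ~: D.
  apply/setP => z; have : z \in E :|: D by rewrite EDT inE.
  rewrite !inE; move/pred0P: dED => /(_ z) /=.
  by case: (z \in E); case: (z \in D).
have /cards1P[x xD] : #|D :\ ord0| == 1%N.
  by have := cardsD1 ord0 D; rewrite xin D2 add1n => -[<-].
have DE : D = [set ord0; x] by rewrite -xD finset.setD1K// xin.
apply/imsetP; exists x.
  have : x \in D :\ ord0 by rewrite xD inE.
  by rewrite !inE => /andP[].
rewrite /pair_split -DE -EC; apply/setP => B; rewrite !inE.
apply/idP/orP => [BQ|[/eqP ->|/eqP ->]//].
by have [->|->] := only E EQ B BQ EDT; [right|left].
Qed.

(** For a centred variable, partitions with a singleton block contribute 0. The full block
    contributes [m_4] and each of the three pair splittings [- m_2^2]. *)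
Lemma cum4_eq0 (d : measure_display) (T : measurableType d) (R : realType)
    (P : probability T R) (X : T -> R) :
  mean P X = 0 -> moment P X 4 = 3 * moment P X 2 ^+ 2 ->
  cum P [tuple X; X; X; X] = 0.
Proof.
move=> X0 X4; rewrite /cum.
pose F (Q : {set {set 'I_4}}) : R := (-1) ^+ #|Q|.-1 * (#|Q|.-1)`!%:R *
  \prod_(D in Q) moment P X #|D|.
rewrite (eq_bigr F) => [|Q _]; last first.
  congr (_ * _); apply: eq_bigr => D _; rewrite /moment /mean.
  congr (fine 'E_P[_])%E; apply/funext => w.
  rewrite -prodr_const; apply: eq_bigr => i _; congr (_ w).
  by rewrite (tnth_nth X); case: i => -[|[|[|[|]]]].
have F1 (Q : {set {set 'I_4}}) (D : {set 'I_4}) : D \in Q -> #|D| = 1%N -> F Q = 0.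
  by move=> DQ D1; rewrite /F (bigD1 D)//= D1 moment1 X0 mul0r mulr0.
have F0 : F [set [set: 'I_4]] = moment P X 4.
  by rewrite /F cards1 big_set1 cardsT card_ord expr0 !mul1r.
have Fx x : x != ord0 -> F (pair_split x) = - moment P X 2 ^+ 2.
  move=> x0; have ne : [set ord0; x] \notin [set ~: [set ord0; x]].
    rewrite inE; apply/eqP => /setP /(_ ord0); by rewrite !inE eqxx.
  rewrite /F /pair_split cardsU1 ne cards1 big_setU1//= big_set1.
  by rewrite card_pair// card_pairC// expr1 mulr1 mulN1r expr2.
have nin : [set [set: 'I_4]] \notin pair_splits.
  apply/imsetP => -[x _] /setP /(_ [set ord0; x]); rewrite !inE eqxx /=.
  move=> /eqP /(congr1 (fun A : {set 'I_4} => #|A|)).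
  by rewrite cardsT card_ord cards2; case: eqP.
pose K := [set [set: 'I_4]] |: pair_splits.
transitivity (\sum_(Q in K) F Q).
  rewrite (bigID (mem K))/= [X in _ + X]big1 ?addr0 => [|Q /andP[pQ]].
    apply: eq_bigl => Q; rewrite andb_idl// !inE => /orP[/eqP ->|/imsetP[x]].
      apply/and3P; split; rewrite ?finset.cover1 ?finset.trivIset1 ?inE//.
      by rewrite eq_sym -card_gt0 cardsT card_ord.
    by rewrite !inE => x0 ->; exact: partition_pair_split.
  rewrite !inE negb_or => /andP[/eqP nT nS].
  have [/existsP[D /andP[DQ /eqP D1]]|nD] :=
    boolP [exists D, (D \in Q) && (#|D| == 1%N)].
    exact: F1 DQ D1.
  have [D DQ|/nT//|] := partition4P pQ; last by rewrite (negbTE nS).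
  by apply: contraNN nD => D1; apply/existsP; exists D; rewrite DQ.
rewrite big_setU1//= F0 (big_imset _ pair_split_inj)/=.
rewrite (eq_bigr (fun=> - moment P X 2 ^+ 2)).
  by rewrite sumr_const cardsC1 card_ord /= X4; ring.
by move=> x; rewrite !inE => /Fx.
Qed.

End FourthCumulant.

(** * The causal model *)

Section Graph.

Lemma acyclic_edge (V : finType) (e : rel V) x y :
  acyclic e -> connect e x y -> ~~ e y x.
Proof.
move=> acyc /connectP[s es ->]; apply/negP => ex.
suff : x :: s = [::] by [].
by apply: acyc; rewrite /= rcons_path es.
Qed.

Lemma connect_causal_graph (R : realType) (p q : nat) (B : 'M[R]_p)
    (Lam : 'M[R]_(p, q)) i j :
  connect (fun l k => B k l != 0) i j ->
  connect (causal_graph B Lam) (inr i) (inr j).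
Proof.
case/connectP=> s es ->; apply/connectP; exists (map inr s).
  by rewrite path_map.
by rewrite last_map.
Qed.

End Graph.

(** * Observed variables as combinations of the components *)

Section Mixing.
Context {d : measure_display} {T : measurableType d} {R : realType}.
Variable P : probability T R.
Context {p q : nat}.

(* [a] is the row of [X k] in the mixing matrix [(I - B)^-1 [Lam, I]]. *)
Lemma mixing_row (B : 'M[R]_p) (Lam : 'M[R]_(p, q)) (L : 'I_q -> {RV P >-> R})
    (SX X : 'I_p -> {RV P >-> R}) (k : 'I_p) :
  canonical_lvLiNGAM B Lam L SX X ->
  exists a : 'I_q + 'I_p -> R,
    [/\ forall w, X k w = \sum_c a c * components L SX c w,
        a (inr k) = 1 &
        forall m, a (inr m) != 0 -> connect (fun j l => B l j != 0) m k].
Proof.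
move=> model; set e : rel 'I_p := fun j l => B l j != 0.
have acyc : acyclic e := lvLiNGAM_acyclic model.
(* Induction on the number of vertices from which [k] is reachable; by acyclicity it is smaller for
   each parent of [k]. *)
have [n] := ubnP #|[set m | connect e m k]|; elim: n k => // n IHn k kn.
have /choice[A HA] : forall j, exists a : 'I_q + 'I_p -> R, B k j != 0 ->
    [/\ forall w, X j w = \sum_c a c * components L SX c w,
        a (inr j) = 1 & forall m, a (inr m) != 0 -> connect e m j].
  (* For a non-parent [j] any row will do, since its weight [B k j] is 0. *)
  move=> j; have [Bkj|Bkj] := eqVneq (B k j) 0; first by exists (fun=> 0).
  have [|a Ha] := IHn j; last by exists a.
  have jk : e j k by [].
  rewrite -ltnS (leq_trans _ kn)// ltnS; apply: proper_card; apply/properP; split.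
    apply/fintype.subsetP => m; rewrite !inE => mj.
    by apply: connect_trans mj _; exact: connect1.
  exists k; rewrite inE ?connect0//.
  by apply/negP => kj; have := acyclic_edge acyc kj; rewrite jk.
pose a c := \sum_j B k j * A j c
  + match c with inl l => Lam k l | inr m => (m == k)%:R end.
exists a; split.
- move=> w; rewrite (lvLiNGAM_eq model) /a.
  rewrite [RHS](eq_bigr (fun c => (\sum_j B k j * A j c) * components L SX c w
    + match c with inl l => Lam k l | inr m => (m == k)%:R end
      * components L SX c w)); last by move=> c _; rewrite mulrDl.
  rewrite big_split /= -addrA; congr (_ + _).
    under [RHS]eq_bigr do rewrite mulr_suml.
    rewrite exchange_big; apply: eq_bigr => j _ /=.
    have [Bkj|Bkj] := eqVneq (B k j) 0.
      by rewrite Bkj mul0r big1// => c _; rewrite !mul0r.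
    have [-> _ _] := HA j Bkj; rewrite mulr_sumr.
    by apply: eq_bigr => c _; rewrite mulrA.
  rewrite big_sumType /=; congr (_ + _).
  rewrite (bigD1 k)//= eqxx mul1r big1 ?addr0// => m /negbTE mk.
  by rewrite mk mul0r.
(* A parent of [k] involving the noise of [k] would be reachable from [k] and close a cycle. *)
- rewrite /a eqxx big1 ?add0r// => j _.
  have [->|Bkj] := eqVneq (B k j) 0; first by rewrite mul0r.
  have [_ _ Aj] := HA j Bkj.
  have [->|/Aj kj] := eqVneq (A j (inr k)) 0; first by rewrite mulr0.
  by have := acyclic_edge acyc kj; rewrite /e Bkj.
- move=> m; have [->|mk] := eqVneq m k; first by rewrite connect0.
  rewrite /a (negbTE mk) addr0 => am.
  have [j Bj] : exists j, B k j * A j (inr m) != 0.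
    apply/existsP; apply: contraNT am; rewrite negb_exists => /forallP h.
    by rewrite big1// => j _; apply/eqP; have := h j; rewrite negbK.
  move: Bj; rewrite mulf_eq0 negb_or => /andP[Bkj Ajm].
  have [_ _ /(_ m Ajm) mj] := HA j Bkj.
  by apply: connect_trans mj _; exact: connect1.
Qed.

End Mixing.

Section Independence.
Context {d : measure_display} {T : measurableType d} {R : realType}.
Variable P : probability T R.

(** The preimages of measurable sets under one variable already form a sigma-algebra, so every
    generated event is such a preimage. *)
Lemma indep_rvP (X Y : T -> R) : indep_pair P X Y -> indep_rv P X Y.
Proof.
have preimages (Z : T -> R) E : sigma_rv setT (fun _ : unit => Z) E ->
    exists2 A : set R, measurable A & E = (Z @^-1` A)%classic.
  move=> ZE; suff : preimage_set_system setT Z measurable E.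
    by case=> A mA <-; exists A => //; rewrite setTI.
  apply: ZE; split.
    by apply: sigma_algebra_preimage; exact: sigma_algebra_measurable.
  by move=> _ [_ [A [_ mA ->]]]; exists A => //; rewrite setTI.
by move=> XY E F /preimages[A mA ->] /preimages[C mC ->]; exact: XY.
Qed.

Lemma indep_vectors_pair (I J : Type) (X : I -> T -> R) (Y : J -> T -> R) i j :
  indep_vectors P X Y -> indep_pair P (X i) (Y j).
Proof.
move=> XY A C mA mC; apply: XY; apply: sub_sigma_algebra.
  by exists i, A.
by exists j, C.
Qed.

End Independence.

Theorem corollary3p7 (d : measure_display) (T : measurableType d)
    (R : realType) (P : probability T R) (p q : nat)
    (B : 'M[R]_p) (Lam : 'M[R]_(p, q))
    (L : 'I_q -> {RV P >-> R}) (SX X : 'I_p -> {RV P >-> R})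
    (model : canonical_lvLiNGAM B Lam L SX X)
    (pure : pure_set_assumption B Lam)
    (three_child : three_child_assumption B Lam)
    (faithful : causal_faithfulness B Lam X)
    (i j : 'I_p) (neq_ij : i != j)
    (dependent : ~ indep_rv P (X i) (X j))
    (olc : one_latent_component P [tuple (X i : T -> R)]
             [tuple (X i : T -> R); (X j : T -> R)]) :
  causally_earlier B Lam i j.
Proof.
case: olc => _ [z [omega [omega0 _ indep]]].
pose S c : T -> R := components L SX c.
have [a [Xi ai _]] := mixing_row i model.
have [b [Xj _ bm]] := mixing_row j model.
pose u := omega ord0 0; pose v := omega (lift ord0 ord0) 0.
have indep_uv : indep_pair P (X i) (fun w => u * X i w + v * X j w).
  move=> A C mA mC; rewrite setIC muleC.
  have := indep_vectors_pair tt ord0 indep mC mA.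
  rewrite (_ : lin_comb _ _ = fun w => u * X i w + v * X j w)//.
  by apply/funext => w; rewrite /lin_comb !big_ord_recl big_ord0 addr0.
(* If the noise of [X i] enters [X j], then [bm] supplies a directed path from [i] to [j]. *)
have [bi|bi] := eqVneq (b (inr i)) 0; last first.
  rewrite /causally_earlier /ancestor connect_causal_graph ?bm// andbT.
  by apply: contra_neq neq_ij => -[].
exfalso; have [u0|u0] := eqVneq u 0.
  have v0 : v != 0.
    apply: contraNneq omega0 => v0; apply/eqP/matrixP => k l; rewrite mxE ord1.
    case: (unliftP ord0 k) => [k'|] ->; last exact: u0.
    by rewrite ord1; exact: v0.
  apply: dependent; apply: indep_rvP.
  have := indep_pairZr v^-1 indep_uv; congr (indep_pair _ _ _).
  by apply/funext => w; rewrite u0 mul0r add0r mulKf.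
have fS c : finite_moments P (S c) := lvLiNGAM_moments model c.
have mS c : mean P (S c) = 0 by rewrite /mean (lvLiNGAM_mean model).
have /eqP := lvLiNGAM_cum4 model (inr i); apply.
apply: cum4_eq0 => //; first exact: (mS (inr i)).
apply: (darmois_skitovich_moment4 fS mS (lvLiNGAM_indep model)
  (a := a) (b := fun c => u * a c + v * b c)).
- move: indep_uv; congr (indep_pair _ _ _); apply/funext => w; first exact: Xi.
  rewrite Xi Xj !mulr_sumr -big_split; apply: eq_bigr => c _ /=.
  by rewrite mulrDl !mulrA.
- by rewrite ai oner_neq0.
- by rewrite ai bi mulr0 addr0 mulr1.
Qed.
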